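(* Let $0<a<b<\infty$ and assign to the edges of the $\mathbb{Z}^2$ nearest-neighbour lattice independent weights $(\omega_e)$, each uniformly distributed on $\{a,b\}$. Let $\alpha<1/22$ and $\beta\in(0,1)$ be fixed. Then for any sequence $(k_n)_{n\ge1}$ of positive integers with $k_n\le n^\alpha$, and for any choice of $\beta$-quantile $q_\beta=q_\beta(n)$ of $\tau(n,k_n)$, we have $$\lim_{n\to\infty}\mathbb{P}\big(\tau(n,k_n)<q_\beta\big)=1-\lim_{n\to\infty}\mathbb{P}\big(\tau(n,k_n)>q_\beta\big)=\beta,$$ and the sequence of functions $f_n:=\mathbbm{1}_{\{\tau(n,k_n)>q_\beta\}}$ is noise sensitive.
   Context: For a path $\Gamma$ (a finite sequence of edges), $T(\Gamma):=\sum_{e\in\Gamma}\omega_e$. For $k\ge1$, $\mathcal{P}_k(n)$ is the set of nearest-neighbour paths contained in $[0,n]\times[0,n-1]$ that connect the left side $\{0\}\times[0,n-1]$ to the right side $\{n\}\times[0,n-1]$ and are contained in $[0,n]\times[m,m+k-1]$ for some integer $m$; and $\tau(n,k):=\inf\{T(\Gamma):\Gamma\in\mathcal{P}_k(n)\}$. A $\beta$-quantile of a random variable $X$ is any $q$ with $\mathbb{P}(X<q)\le\beta\le\mathbb{P}(X\le q)$. Each $f_n$ depends only on the finitely many weights of edges in $[0,n]\times[0,n-1]$, so it is a function on $\{a,b\}^{E_n}$ ($E_n$ that finite edge set) equipped with the uniform product measure. Given $\omega$, let $\omega^\varepsilon$ be obtained by independently, for each edge, resampling $\omega_e$ (from the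 uniform distribution on $\{a,b\}$) with probability $\varepsilon$. A sequence $(f_n)$ of such $\{0,1\}$-valued functions is noise sensitive if for every $\varepsilon>0$, $\mathbb{E}[f_n(\omega)f_n(\omega^\varepsilon)]-\mathbb{E}[f_n(\omega)]^2\to0$ as $n\to\infty$. *)

(* Defs.v *)
From HB Require Import structures.
From mathcomp Require Import all_boot all_order all_algebra.
From mathcomp Require Import all_classical all_reals all_analysis.
Set Implicit Arguments. Unset Strict Implicit. Unset Printing Implicit Defensive.
Import Order.TTheory GRing.Theory Num.Theory.
Import numFieldNormedType.Exports.
Local Open Scope classical_set_scope.
Local Open Scope ring_scope.

(* Candidate edge of the box [0,n] x [0,n-1]: (x, y, d) is the edge from (x,y)
   to (x+1,y) if d = false (horizontal) and to (x,y+1) if d = true (vertical). *)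
Definition edge_okb (n : nat) (e : 'I_n.+1 * 'I_n * bool) : bool :=
  let: (x, y, d) := e in
  if d then (y.+1 < n)%N else (x < n)%N.

Definition E (n : nat) := {e : 'I_n.+1 * 'I_n * bool | edge_okb e}.

(* configurations in {a,b}^{E_n}: true encodes weight b, false weight a *)
Definition config (n : nat) := {ffun E n -> bool}.

Definition wt {R : realType} (a b : R) (c : bool) : R := if c then b else a.

Definition edge_p1 n (e : E n) : nat * nat :=
  let: (x, y, d) := val e in (nat_of_ord x, nat_of_ord y).
Definition edge_p2 n (e : E n) : nat * nat :=
  let: (x, y, d) := val e in
  if d then (nat_of_ord x, (nat_of_ord y).+1) else ((nat_of_ord x).+1, nat_of_ord y).

Definition edge_joins n (e : E n) (u v : nat * nat) : bool :=
  ((edge_p1 e == u) && (edge_p2 e == v)) || ((edge_p1 e == v) && (edge_p2 e == u)).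

Definition adj (u v : nat * nat) : bool :=
  ((u.1 == v.1) && ((u.2 == v.2.+1) || (v.2 == u.2.+1))) ||
  ((u.2 == v.2) && ((u.1 == v.1.+1) || (v.1 == u.1.+1))).

(* weight of the edge between u and v (exactly one edge of E_n joins them when
   u, v are adjacent points of the box) *)
Definition step_wt {R : realType} (a b : R) n (w : config n) (u v : nat * nat) : R :=
  \sum_(e : E n | edge_joins e u v) wt a b (w e).

Definition passage {R : realType} (a b : R) n (w : config n) (p : seq (nat * nat)) : R :=
  \sum_(uv <- zip p (behead p)) step_wt a b w uv.1 uv.2.

Definition Pk (n k : nat) : set (seq (nat * nat)) :=
  [set p | exists x0 s, p = x0 :: s /\
     path adj x0 s /\
     all (fun u => (u.1 <= n)%N && (u.2 < n)%N) p /\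
     x0.1 = 0%N /\ (last x0 s).1 = n /\
     exists m : int, all (fun u : nat * nat => (m <= Posz u.2) && (Posz u.2 <= m + Posz k - 1)) p].

Definition tau {R : realType} (a b : R) (n k : nat) (w : config n) : R :=
  inf [set passage a b w p | p in Pk n k].
Arguments tau {R} a b n k w.

Definition Prob {R : realType} n (A : config n -> bool) : R :=
  #|[set w : config n | A w]|%:R / #|{: config n}|%:R.

Definition Expect {R : realType} n (f : config n -> bool) : R :=
  \sum_(w : config n) (f w)%:R / #|{: config n}|%:R.

(* joint law of (w_e, w^eps_e) for one edge *)
Definition noise_kernel {R : realType} (eps : R) (x y : bool) : R :=
  2^-1 * ((1 - eps) * (x == y)%:R + eps / 2).

(* E[f(w) f(w^eps)] *)
Definition noise_corr {R : realType} (eps : R) n (f : config n -> bool) : R :=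
  \sum_(w : config n) \sum_(w' : config n)
    (f w)%:R * (f w')%:R * \prod_(e : E n) noise_kernel eps (w e) (w' e).

Definition noise_sensitive {R : realType} (f : forall n, config n -> bool) : Prop :=
  forall eps : R, 0 < eps -> eps <= 1 ->
    (fun n => noise_corr eps (f n) - (Expect (f n)) ^+ 2) @ \oo --> (0 : R).

Definition is_quantile {R : realType} (beta : R) n (X : config n -> R) (q : R) : Prop :=
  Prob (fun w => X w < q) <= beta <= Prob (fun w => X w <= q).

(* Main.v *)
Require Import Defs.
From HB Require Import structures.
From mathcomp Require Import all_boot all_order all_algebra.
From mathcomp Require Import all_classical all_reals all_analysis.
From mathcomp Require Import zify ring lra.
Set Implicit Arguments. Unset Strict Implicit. Unset Printing Implicit Defensive.
Import Order.TTheory GRing.Theory Num.Theory.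
Import numFieldNormedType.Exports.
Local Open Scope ring_scope.

(* tau is the minimum over the n - k + 1 windows of k consecutive rows of the
   crossing time of the window, and windows with disjoint rows are independent.
   Since P(tau < q) <= beta < 1, the probabilities of the events that a window has
   crossing time < q add up to at most k / (1 - beta).

   No atom at q. In one window, make each edge cheap with probability
   (1 + delta) / 2. This lowers the crossing time by at least b - a as soon as one
   edge of weight b on the geodesic is switched. There are order n / k such edges:
   by self-duality each k x k box is crossed by edges of weight a with probability
   at most 1/2. On the other hand the density rho of the tilted law has
   E (rho - 1)^4 = O((n k delta^2)^2), so
   |rho - 1| <= lambda + (rho - 1)^4 / lambda^3 shows that tilting multiplies the
   probability of an event of order 1/n by at most 1 + lambda. With delta close to
   n^(-7/8) and lambda = eta / k both effects are compatible for k^22 <= n, and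
   P(crossing time <= q) <= (1 + lambda) P(crossing time < q) + o(1/n).

   Noise sensitivity. Resample completely the rows, one block of 2k rows at a
   time. Each such change alters the correlation by at most P(U and U'), where U is
   the event that some window meeting the block has crossing time <= q. Small set
   expansion gives P(U and U') = o(P(U)) because P(U) is small, and the P(U) have a
   bounded sum by independence. *)

(** * Uniform random configurations *)

Lemma bernoulli_le (R : realDomainType) (x : R) n : 0 <= x -> 1 + n%:R * x <= (1 + x) ^+ n.
Proof.
move=> x0; elim: n => [|n IH]; first by rewrite mul0r addr0 expr0.
rewrite exprS -natr1; apply: le_trans (ler_wpM2l _ IH); last by rewrite addr_ge0.
by rewrite -subr_ge0 [X in 0 <= X](_ : _ = n%:R * x ^+ 2) ?mulr_ge0 ?sqr_ge0 ?ler0n //; ring.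
Qed.

Section UniformMean.
Variables (R : realType) (T : finType).
Local Notation cfg := {ffun T -> bool}.
Implicit Types (F G : cfg -> R) (A B : cfg -> bool) (S : pred T).

Definition mean F : R := (\sum_w F w) / #|{: cfg}|%:R.

Lemma card_cfg : #|{: cfg}|%:R = 2 ^+ #|T| :> R.
Proof. by rewrite card_ffun card_bool natrX. Qed.

Lemma card_cfg_gt0 : 0 < #|{: cfg}|%:R :> R.
Proof. by rewrite card_cfg exprn_gt0. Qed.

Lemma meanE F : mean F = \sum_w F w / #|{: cfg}|%:R.
Proof. by rewrite /mean mulr_suml. Qed.

Lemma eq_mean F G : F =1 G -> mean F = mean G.
Proof. by move=> FG; rewrite /mean (eq_bigr _ (fun w _ => FG w)). Qed.

Lemma ler_mean F G : (forall w, F w <= G w) -> mean F <= mean G.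
Proof.
by move=> FG; rewrite /mean ler_wpM2r ?invr_ge0 ?ler0n // ler_sum // => w _.
Qed.

Lemma mean_ge0 F : (forall w, 0 <= F w) -> 0 <= mean F.
Proof. by move=> F0; rewrite divr_ge0 ?ler0n // sumr_ge0. Qed.

Lemma meanD F G : mean (fun w => F w + G w) = mean F + mean G.
Proof. by rewrite /mean big_split mulrDl. Qed.

Lemma meanB F G : mean (fun w => F w - G w) = mean F - mean G.
Proof. by rewrite /mean sumrB mulrBl. Qed.

Lemma meanZ c F : mean (fun w => c * F w) = c * mean F.
Proof. by rewrite /mean -mulr_sumr mulrA. Qed.

Lemma mean_cst c : mean (fun=> c) = c.
Proof. by rewrite /mean sumr_const -[c *+ _]mulr_natr mulfK // gt_eqF // card_cfg_gt0. Qed.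

Lemma mean_sum (I : Type) (r : seq I) (P : pred I) (F : I -> cfg -> R) :
  mean (fun w => \sum_(i <- r | P i) F i w) = \sum_(i <- r | P i) mean (F i).
Proof. by rewrite /mean exchange_big /= mulr_suml. Qed.

Lemma mean_inj (h : cfg -> cfg) F : injective h -> mean (F \o h) = mean F.
Proof. by move=> hI; rewrite /mean [in RHS](reindex_inj hI). Qed.

Lemma mean_prod (K : T -> bool -> R) :
  mean (fun w => \prod_e K e (w e)) = \prod_e ((K e false + K e true) / 2).
Proof.
rewrite /mean card_cfg -[in RHS](eq_bigr _ (fun e _ => mulrC 2^-1 _)).
rewrite big_split prodr_const /= mulrC exprVn; congr (_ * _).
rewrite -(bigA_distr_bigA K) /=.
by apply: eq_bigr => e _; rewrite big_bool addrC.
Qed.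

Definition depends_on (X : Type) S (F : cfg -> X) : Prop :=
  forall w w' : cfg, (forall e, S e -> w e = w' e) -> F w = F w'.

Definition prob A : R := mean (fun w => (A w)%:R).

Lemma prob_ge0 A : 0 <= prob A.
Proof. by apply: mean_ge0 => w; rewrite ler0n. Qed.

Lemma le_prob A B : (forall w, A w -> B w) -> prob A <= prob B.
Proof.
move=> AB; apply: ler_mean => w; rewrite ler_nat.
by case: (A w) (AB w) => // ->.
Qed.

Lemma eq_prob A B : A =1 B -> prob A = prob B.
Proof. by move=> AB; apply: eq_mean => w; rewrite AB. Qed.

Lemma prob_le1 A : prob A <= 1.
Proof. by rewrite -[1](mean_cst 1); apply: ler_mean => w; rewrite lern1 leq_b1. Qed.

Lemma probC A : prob (fun w => ~~ A w) = 1 - prob A.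
Proof.
rewrite /prob -[X in X - _](mean_cst 1) -meanB; apply: eq_mean => w.
by case: (A w); rewrite /= ?subrr ?subr0.
Qed.

Lemma prob_union_le (I : finType) (P : pred I) (A : I -> cfg -> bool) :
  prob (fun w => [exists i, P i && A i w]) <= \sum_(i | P i) prob (A i).
Proof.
rewrite -mean_sum; apply: ler_mean => w.
case: existsP => [[i /andP[Pi Ai]]|_]; last by apply: sumr_ge0 => i _; rewrite ler0n.
by rewrite (bigD1 i) //= Ai lerDl sumr_ge0 // => j _; rewrite ler0n.
Qed.

Definition mix S (w w' : cfg) : cfg := [ffun e => if S e then w e else w' e].

(* Swapping the coordinates outside [S] between two independent copies turns
   [F w * G w'] into [F w * G w]. *)
Lemma mean_indep S F G : depends_on S F -> depends_on (predC S) G ->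
  mean (fun w => F w * G w) = mean F * mean G.
Proof.
move=> dF dG.
have c0 : (#|{: cfg}|%:R : R) != 0 by rewrite gt_eqF // card_cfg_gt0.
have swK : involutive (fun p : cfg * cfg => (mix S p.1 p.2, mix S p.2 p.1)).
  by move=> [w w'] /=; congr pair; apply/ffunP => e; rewrite !ffunE; case: (S e).
have key : (\sum_w F w) * (\sum_w G w) = (\sum_w F w * G w) * #|{: cfg}|%:R.
  rewrite big_distrlr /= pair_big /= (reindex_inj (inv_inj swK)) /=.
  rewrite (eq_bigr (fun p => F p.1 * G p.1)) => [|[w w'] _ /=].
    rewrite -(pair_big predT predT (fun w w' : cfg => F w * G w)) /= mulr_suml.
    by apply: eq_bigr => w _; rewrite sumr_const mulr_natr.
  congr (_ * _); first by apply: dF => e Se; rewrite ffunE Se.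
  by apply: dG => e /negbTE Se; rewrite ffunE Se.
by rewrite /mean mulrACA key -mulrA mulVKf.
Qed.

Lemma mean_indep_prod (I : eqType) (r : seq I) (P : pred I) (S : I -> pred T)
  (F : I -> cfg -> R) : uniq r ->
  (forall i, P i -> depends_on (S i) (F i)) ->
  (forall i j e, P i -> P j -> S i e -> S j e -> i = j) ->
  mean (fun w => \prod_(i <- r | P i) F i w) = \prod_(i <- r | P i) mean (F i).
Proof.
elim: r => [|i r IH] /=; first by move=> *; rewrite big_nil -[RHS](mean_cst 1); apply: eq_mean => w; rewrite big_nil.
move=> /andP[ir ur] dF dis; rewrite big_cons.
case Pi : (P i); last by rewrite -IH //; apply: eq_mean => w; rewrite big_cons Pi.
rewrite -IH // -(@mean_indep (S i)); first by apply: eq_mean => w; rewrite big_cons Pi.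
  exact: dF.
move=> w w' ww; rewrite big_seq_cond [RHS]big_seq_cond; apply: eq_bigr => j /andP[jr Pj].
apply: (dF j Pj) => e Sje; apply: ww => /=; apply/negP => Sie.
by move: ir; rewrite (dis i j e Pi Pj Sie Sje) jr.
Qed.

End UniformMean.

(** Induction: one more event of probability p, with s the sum over the others, replaces 1 + s by (1
    - p)(1 + p + s) = 1 + s - p (p + s). *)
Lemma prod_onem_le (R : realType) (I : Type) (r : seq I) (P : pred I) (p : I -> R) :
  (forall i, P i -> 0 <= p i <= 1) ->
  (\prod_(i <- r | P i) (1 - p i)) * (1 + \sum_(i <- r | P i) p i) <= 1.
Proof.
move=> p01; elim: r => [|i r IH]; first by rewrite !big_nil mul1r addr0.
rewrite !big_cons; case Pi : (P i) => //.
have /andP[p0 p1] := p01 i Pi.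
have s0 : 0 <= \sum_(j <- r | P j) p j by apply: sumr_ge0 => j /p01 /andP[].
have q0 : 0 <= \prod_(j <- r | P j) (1 - p j).
  by apply: prodr_ge0 => j /p01 /andP[_ ?]; rewrite subr_ge0.
apply: le_trans IH; rewrite mulrAC mulrC; apply: ler_wpM2l => //.
set s := \sum_(_ <- _ | _) _ in s0 *; nra.
Qed.

(* For independent events, [\prod (1 - p_i) * (1 + \sum p_i) <= 1] bounds the sum
   of the probabilities by the inverse of the probability that none occurs. *)
Lemma sum_prob_le_none (R : realType) (T : finType) (I : finType) (P : pred I)
  (S : I -> pred T) (A : I -> {ffun T -> bool} -> bool) (c : R) :
  (forall i, P i -> depends_on (S i) (A i)) ->
  (forall i j e, P i -> P j -> S i e -> S j e -> i = j) ->
  0 < c -> c <= prob R (fun w => ~~ [exists i, P i && A i w]) ->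
  \sum_(i | P i) prob R (A i) <= c^-1.
Proof.
move=> dA dis c0 cle.
have E : prob R (fun w => ~~ [exists i, P i && A i w]) = \prod_(i | P i) (1 - prob R (A i)).
  rewrite -(eq_bigr _ (fun i _ => probC _ (A i))) /prob -(@mean_indep_prod R T I _ _ S) //.
  - apply: eq_mean => w; case: existsP => [[i /andP[Pi Ai]]|N] /=.
      by rewrite (bigD1 i) //= Ai mul0r.
    rewrite big1 // => i Pi; case Ai : (A i w) => //.
    by case: N; exists i; rewrite Pi.
  - exact: index_enum_uniq.
  - by move=> i Pi w w' ww; rewrite (dA i Pi w w' ww).
have := @prod_onem_le R I (index_enum I) P (fun i => prob R (A i)).
rewrite -E => H.
have {}H := H (fun i _ => introT andP (conj (prob_ge0 R (A i)) (prob_le1 R (A i)))).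
set s := \sum_(i | P i) _ in H *.
have s0 : 0 <= s by apply: sumr_ge0 => i _; apply: prob_ge0.
rewrite -[c^-1]mul1r ler_pdivlMr // mulrC.
apply: le_trans H; apply: le_trans (_ : c * (1 + s) <= _).
  by rewrite mulrDr mulr1 lerDr ltW.
by apply: ler_wpM2r => //; rewrite addr_ge0.
Qed.

(** * Small set expansion for the noise operator *)

Section SmallSetExpansion.
Variable R : realType.
Implicit Types (eps rho x y z X Y : R).

Local Notation nk := (@noise_kernel R).

Lemma noise_kernel_ge0 eps s t : 0 <= eps <= 1 -> 0 <= nk eps s t.
Proof. by move=> /andP[? ?]; rewrite /noise_kernel; case: (s == t) => /=; lra. Qed.

Lemma noise_kernelC eps s t : nk eps s t = nk eps t s.
Proof. by rewrite /noise_kernel eq_sym. Qed.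

Lemma noise_kernel_mass eps s : nk eps s false + nk eps s true = 2^-1.
Proof. by rewrite /noise_kernel; case: s => /=; field. Qed.

(** Composing the noise squares the correlation [1 - eps]. The factor 1/2 appears because the kernel
    is a joint law, with mass 1/2 on each value of a bit. *)
Lemma noise_kernel_comp eps s t :
  nk eps s false * nk eps false t + nk eps s true * nk eps true t =
  2^-1 * nk (1 - (1 - eps) ^+ 2) s t.
Proof. by rewrite /noise_kernel; case: s; case: t => /=; field. Qed.

(* Bonami's inequality from L^{4/3} to L^2 on one bit, in polynomial form *)
Lemma two_point_poly x y : 0 <= x -> 0 <= y ->
  (5 * (x ^+ 6 + y ^+ 6) + 6 * (x * y) ^+ 3) ^+ 2 <= 32 * (x ^+ 4 + y ^+ 4) ^+ 3.
Proof.
move=> x0 y0; rewrite -subr_ge0.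
have -> : 32 * (x ^+ 4 + y ^+ 4) ^+ 3 - (5 * (x ^+ 6 + y ^+ 6) + 6 * (x * y) ^+ 3) ^+ 2 =
  (x - y) ^+ 2 * (7 * x ^+ 10 + 21 * x ^+ 8 * y ^+ 2 + 11 * x ^+ 6 * y ^+ 4
    + 11 * x ^+ 4 * y ^+ 6 + 21 * x ^+ 2 * y ^+ 8 + 7 * y ^+ 10
    + x * y ^+ 5 * (14 * (y ^+ 2) ^+ 2 - 32 * x ^+ 2 * y ^+ 2 + 27 * (x ^+ 2) ^+ 2)
    + x ^+ 5 * y * (14 * (x ^+ 2) ^+ 2 - 32 * x ^+ 2 * y ^+ 2 + 27 * (y ^+ 2) ^+ 2)).
  by ring.
have H s t : 0 <= 14 * s ^+ 2 - 32 * t * s + 27 * t ^+ 2 :> R.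
  have -> : 14 * s ^+ 2 - 32 * t * s + 27 * t ^+ 2 =
    14 * (s - 16 / 14 * t) ^+ 2 + (27 - 256 / 14) * t ^+ 2 :> R by field.
  by rewrite addr_ge0 // mulr_ge0 ?sqr_ge0 //; lra.
have H1 := H (y ^+ 2) (x ^+ 2).
have H2 := H (x ^+ 2) (y ^+ 2); rewrite -(mulrA 32) (mulrC (y ^+ 2)) (mulrA 32) in H2.
apply: mulr_ge0; first exact: sqr_ge0.
by rewrite !addr_ge0 // !mulr_ge0 // ?exprn_ge0.
Qed.

(** The functions are cubes, so fourth powers measure their L^{4/3} norm. The left side is largest
    at [eps = 3/4], where it is 1/16 of the quantity squared in [two_point_poly]. *)
Lemma two_point_diag eps x y X : 3/4 <= eps <= 1 -> 0 <= x -> 0 <= y -> 0 <= X ->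
  (x ^+ 4 + y ^+ 4) / 2 <= X ^+ 4 ->
  4^-1 * ((x ^+ 3 + y ^+ 3) ^+ 2 + (1 - eps) * (x ^+ 3 - y ^+ 3) ^+ 2) <= X ^+ 6.
Proof.
move=> /andP[e1 e2] x0 y0 X0 xyX.
apply: (@le_trans _ _ ((5 * (x ^+ 6 + y ^+ 6) + 6 * (x * y) ^+ 3) / 16)).
  have -> : (5 * (x ^+ 6 + y ^+ 6) + 6 * (x * y) ^+ 3) / 16 =
    4^-1 * ((x ^+ 3 + y ^+ 3) ^+ 2 + 4^-1 * (x ^+ 3 - y ^+ 3) ^+ 2) by field.
  by apply: ler_wpM2l; [lra|rewrite lerD2l ler_wpM2r ?sqr_ge0 //; lra].
rewrite -(@ler_pXn2r _ 2) ?nnegrE ?exprn_ge0 //; last first.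
  by rewrite divr_ge0 // addr_ge0 // mulr_ge0 // ?addr_ge0 ?exprn_ge0 // mulr_ge0.
rewrite exprMn exprVn -exprM ler_pdivrMr //.
apply: le_trans (two_point_poly x0 y0) _.
have -> : X ^+ (6 * 2) * 16 ^+ 2 = 32 * (2 * X ^+ 4) ^+ 3 by ring.
rewrite ler_pM2l //; apply: lerXn2r; rewrite ?nnegrE ?addr_ge0 ?mulr_ge0 ?exprn_ge0 //.
by rewrite ler_pdivrMr // mulrC in xyX.
Qed.

(** The form is positive semidefinite for [eps <= 1], so Cauchy-Schwarz reduces it to the two
    diagonal cases. *)
Lemma two_point eps (u v : bool -> R) X Y : 3/4 <= eps <= 1 ->
  (forall s, 0 <= u s) -> (forall s, 0 <= v s) -> 0 <= X -> 0 <= Y ->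
  (u false ^+ 4 + u true ^+ 4) / 2 <= X ^+ 4 ->
  (v false ^+ 4 + v true ^+ 4) / 2 <= Y ^+ 4 ->
  \sum_s \sum_t nk eps s t * (u s ^+ 3 * v t ^+ 3) <= X ^+ 3 * Y ^+ 3.
Proof.
move=> e34 u0 v0 X0 Y0 uX vY.
have dX := two_point_diag e34 (u0 false) (u0 true) X0 uX.
have dY := two_point_diag e34 (v0 false) (v0 true) Y0 vY.
have -> : \sum_s \sum_t nk eps s t * (u s ^+ 3 * v t ^+ 3) =
  4^-1 * ((u false ^+ 3 + u true ^+ 3) * (v false ^+ 3 + v true ^+ 3) +
   (1 - eps) * ((u false ^+ 3 - u true ^+ 3) * (v false ^+ 3 - v true ^+ 3))).
  by rewrite !big_bool /noise_kernel /=; field.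
set p := u false ^+ 3 + _ in dX *; set m := u false ^+ 3 - _ in dX *.
set p' := v false ^+ 3 + _ in dY *; set m' := v false ^+ 3 - _ in dY *.
have {}dX : 4^-1 * (p ^+ 2 + (1 - eps) * m ^+ 2) <= (X ^+ 3) ^+ 2 by rewrite -exprM.
have {}dY : 4^-1 * (p' ^+ 2 + (1 - eps) * m' ^+ 2) <= (Y ^+ 3) ^+ 2 by rewrite -exprM.
have r0 : 0 <= 1 - eps by lra.
have [N|P] := leP (p * p' + (1 - eps) * (m * m')) 0.
  by apply: (@le_trans _ _ 0); [lra|rewrite mulr_ge0 // exprn_ge0].
rewrite -(@ler_pXn2r _ 2) ?nnegrE ?mulr_ge0 ?exprn_ge0 ?(ltW P) //.
rewrite [leRHS]exprMn; apply: le_trans (ler_pM _ _ dX dY).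
- rewrite -subr_ge0.
  have -> : 4^-1 * (p ^+ 2 + (1 - eps) * m ^+ 2) * (4^-1 * (p' ^+ 2 + (1 - eps) * m' ^+ 2))
    - (4^-1 * (p * p' + (1 - eps) * (m * m'))) ^+ 2 =
    (4^-1) ^+ 2 * ((1 - eps) * (p * m' - m * p') ^+ 2) by ring.
  by apply: mulr_ge0; [exact: sqr_ge0|apply: mulr_ge0 => //; exact: sqr_ge0].
- by apply: mulr_ge0 => //; apply: addr_ge0; [exact: sqr_ge0|apply: mulr_ge0 => //; exact: sqr_ge0].
- by apply: mulr_ge0 => //; apply: addr_ge0; [exact: sqr_ge0|apply: mulr_ge0 => //; exact: sqr_ge0].
Qed.

Definition ffun_cons N (b : bool) (w : {ffun 'I_N -> bool}) : {ffun 'I_N.+1 -> bool} :=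
  [ffun i => if unlift ord0 i is Some j then w j else b].

Lemma sum_ffun_cons N (F : {ffun 'I_N.+1 -> bool} -> R) :
  \sum_w F w = \sum_b \sum_w F (ffun_cons b w).
Proof.
rewrite pair_big /= (reindex (fun p : bool * {ffun 'I_N -> bool} => ffun_cons p.1 p.2)) //=.
exists (fun w : {ffun 'I_N.+1 -> bool} => (w ord0, [ffun j => w (lift ord0 j)])).
  move=> [b w] _ /=; rewrite ffunE unlift_none; congr pair.
  by apply/ffunP => j; rewrite !ffunE liftK.
move=> w _; apply/ffunP => i; rewrite ffunE /=.
by case: unliftP => [j ->|->] //; rewrite ffunE.
Qed.

Lemma root4 x : 0 <= x -> exists2 y, 0 <= y & y ^+ 4 = x.
Proof.
move=> x0; exists (Num.sqrt (Num.sqrt x)); first exact: sqrtr_ge0.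
by rewrite (exprM _ 2 2) !sqr_sqrtr ?sqrtr_ge0.
Qed.

(** The noise level may vary with the coordinate, so that blocks can be resampled completely one
    after another. *)
Definition noise_form (T : finType) (eps : T -> R) (g h : {ffun T -> bool} -> R) : R :=
  \sum_w \sum_w' g w * h w' * \prod_e nk (eps e) (w e) (w' e).

Lemma noise_form_cons N (eps : 'I_N.+1 -> R) (g h : {ffun 'I_N.+1 -> bool} -> R) :
  noise_form eps g h = \sum_s \sum_t nk (eps ord0) s t *
    noise_form (eps \o lift ord0) (g \o ffun_cons s) (h \o ffun_cons t).
Proof.
rewrite /noise_form sum_ffun_cons; apply: eq_bigr => s _.
under eq_bigr do rewrite sum_ffun_cons.
rewrite exchange_big /=; apply: eq_bigr => t _; rewrite mulr_sumr; apply: eq_bigr => w _.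
rewrite mulr_sumr; apply: eq_bigr => w' _.
rewrite big_ord_recl !ffunE unlift_none mulrCA; congr (_ * (_ * _)).
by apply: eq_bigr => i _; rewrite !ffunE liftK.
Qed.

(* Two-function form of the L^{4/3} hypercontractive inequality, for the cubes of
   [U] and [V] so that no fractional powers are needed *)
Lemma noise_form_tensor N (eps : 'I_N -> R) (U V : {ffun 'I_N -> bool} -> R) X Y :
  (forall i, 3/4 <= eps i <= 1) ->
  (forall w, 0 <= U w) -> (forall w, 0 <= V w) -> 0 <= X -> 0 <= Y ->
  \sum_w U w ^+ 4 <= 2 ^+ N * X ^+ 4 -> \sum_w V w ^+ 4 <= 2 ^+ N * Y ^+ 4 ->
  noise_form eps (fun w => U w ^+ 3) (fun w => V w ^+ 3) <= X ^+ 3 * Y ^+ 3.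
Proof.
elim: N eps U V X Y => [|N IH] eps U V X Y e34 U0 V0 X0 Y0 UX VY.
  have w0 : forall w : {ffun 'I_0 -> bool}, w = [ffun=> false].
    by move=> w; apply/ffunP => -[].
  have s0 F : \sum_(w : {ffun 'I_0 -> bool}) F w = F [ffun=> false] :> R.
    rewrite (eq_bigr (fun=> F [ffun=> false])) => [|w _]; last by rewrite -(w0 w).
    by rewrite sumr_const card_ffun card_ord expn0.
  rewrite /noise_form !s0 big_ord0 mulr1.
  rewrite !s0 expr0 !mul1r in UX VY.
  have {}UX : U [ffun=> false] <= X by rewrite -(@ler_pXn2r _ 4) ?nnegrE.
  have {}VY : V [ffun=> false] <= Y by rewrite -(@ler_pXn2r _ 4) ?nnegrE.
  by apply: ler_pM; rewrite ?exprn_ge0 // lerXn2r ?nnegrE.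
(* [n s] is the L^4 norm of the slice with first bit [s]. The induction hypothesis treats each pair
   of slices and [two_point] the first bit. *)
have rt (W : {ffun 'I_N.+1 -> bool} -> R) : (forall w, 0 <= W w) -> exists2 n : bool -> R, (forall s, 0 <= n s) &
    forall s, \sum_w W (ffun_cons s w) ^+ 4 = 2 ^+ N * n s ^+ 4.
  move=> W0; have H s : exists y, 0 <= y /\ \sum_w W (ffun_cons s w) ^+ 4 = 2 ^+ N * y ^+ 4.
    have [|y y0 yE] := @root4 ((\sum_w W (ffun_cons s w) ^+ 4) / 2 ^+ N).
      by rewrite divr_ge0 ?exprn_ge0 // sumr_ge0 // => w _; rewrite exprn_ge0.
    by exists y; split; rewrite // yE mulrC divfK // gt_eqF // exprn_gt0.
  have [yf [yf0 yfE]] := H false; have [yt [yt0 ytE]] := H true.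
  by exists (fun s => if s then yt else yf) => -[].
have [u u0 uE] := rt U U0; have [v v0 vE] := rt V V0.
rewrite noise_form_cons.
apply: le_trans (two_point (eps := eps ord0) (u := u) (v := v) _ _ _ X0 Y0 _ _) => //.
- apply: ler_sum => s _; apply: ler_sum => t _; apply: ler_wpM2l.
    apply: noise_kernel_ge0; have /andP[H1 ->] := e34 ord0; rewrite andbT; exact: le_trans H1.
  apply: (IH _ (U \o ffun_cons s) (V \o ffun_cons t)) => //= *; rewrite ?uE ?vE //.
- rewrite -(@ler_pM2l _ (2 ^+ N.+1)) ?exprn_gt0 //; apply: le_trans UX.
  by rewrite sum_ffun_cons big_bool /= !uE exprS le_eqVlt; apply/orP; left; apply/eqP; field.
- rewrite -(@ler_pM2l _ (2 ^+ N.+1)) ?exprn_gt0 //; apply: le_trans VY.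
  by rewrite sum_ffun_cons big_bool /= !vE exprS le_eqVlt; apply/orP; left; apply/eqP; field.
Qed.

Variable T : finType.
Local Notation cfg := {ffun T -> bool}.
Implicit Types (f g h : cfg -> R) (A : cfg -> bool).

Definition ffun_ord (w : cfg) : {ffun 'I_#|T| -> bool} := [ffun i => w (enum_val i)].
Definition ffun_unord (w : {ffun 'I_#|T| -> bool}) : cfg := [ffun e => w (enum_rank e)].

Lemma ffun_ordK : cancel ffun_ord ffun_unord.
Proof. by move=> w; apply/ffunP => e; rewrite !ffunE enum_rankK. Qed.
Lemma ffun_unordK : cancel ffun_unord ffun_ord.
Proof. by move=> w; apply/ffunP => e; rewrite !ffunE enum_valK. Qed.

Lemma sum_unord (F : cfg -> R) : \sum_w F w = \sum_w F (ffun_unord w).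
Proof.
rewrite (reindex ffun_unord) //; exists ffun_ord => w _; [exact: ffun_unordK|exact: ffun_ordK].
Qed.

(** Indicators equal their cubes and fourth powers, so the hypercontractive bound reads p^(3/2) with
    p = [prob R A]; squaring avoids the root. *)
Lemma noise_form_indicator (eps : T -> R) A : (forall e, 3/4 <= eps e <= 1) ->
  noise_form eps (fun w => (A w)%:R) (fun w => (A w)%:R) ^+ 2 <= prob R A ^+ 3.
Proof.
move=> e34; have [x x0 xE] := root4 (prob_ge0 R A).
pose U (w : {ffun 'I_#|T| -> bool}) : R := (A (ffun_unord w))%:R.
have UX : \sum_w U w ^+ 4 <= 2 ^+ #|T| * x ^+ 4.
  rewrite xE /prob /mean sum_unord card_cfg mulrC divfK ?gt_eqF ?exprn_gt0 //.
  by apply: ler_sum => w _; rewrite /U; case: (A _); rewrite ?expr0n ?expr1n.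
pose eps' (i : 'I_#|T|) : R := eps (enum_val i).
have e34' i : 3/4 <= eps' i <= 1 := e34 (enum_val i).
have U0 w : 0 <= U w by rewrite ler0n.
have := noise_form_tensor e34' U0 U0 x0 x0 UX UX.
have -> : noise_form eps' (fun w => U w ^+ 3) (fun w => U w ^+ 3) =
    noise_form eps (fun w => (A w)%:R) (fun w => (A w)%:R).
  rewrite /noise_form [RHS]sum_unord; apply: eq_bigr => w _.
  rewrite [RHS]sum_unord; apply: eq_bigr => w' _.
  have C w1 : U w1 ^+ 3 = (A (ffun_unord w1))%:R.
    by rewrite /U; case: (A _); rewrite ?expr0n ?expr1n.
  rewrite !C; congr (_ * _); rewrite [RHS](reindex (fun i : 'I_#|T| => enum_val i)) /=.
    by apply: eq_bigr => i _; rewrite !ffunE enum_valK.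
  by exists enum_rank => e _; rewrite ?enum_valK ?enum_rankK.
move=> H; rewrite -xE -exprM (_ : (4 * 3 = 6 * 2)%N) // [leRHS]exprM lerXn2r ?nnegrE ?exprn_ge0 //.
  rewrite sumr_ge0 // => w _; rewrite sumr_ge0 // => w' _.
  rewrite !mulr_ge0 ?ler0n // prodr_ge0 // => e _.
  by apply: noise_kernel_ge0; have /andP[? ?] := e34 e; apply/andP; split; lra.
by rewrite (_ : 6%N = 3 + 3)%N // exprD.
Qed.

(** Lagrange's identity: twice the defect is a double sum of squares. *)
Lemma sum_sqr_CS (F G : cfg -> R) :
  (\sum_w F w * G w) ^+ 2 <= (\sum_w F w ^+ 2) * (\sum_w G w ^+ 2).
Proof.
rewrite -subr_ge0 expr2 !big_distrlr /= -(pmulr_rge0 _ (ltr0n R 2)).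
have -> : 2 * (\sum_i \sum_j F i ^+ 2 * G j ^+ 2 - \sum_i \sum_j F i * G i * (F j * G j)) =
   \sum_i \sum_j (F i * G j - F j * G i) ^+ 2.
  rewrite mulrBr [X in X - _]mulr_natl mulr2n [X in _ + X - _]exchange_big /=.
  rewrite -big_split mulr_sumr -sumrB /=; apply: eq_bigr => i _.
  rewrite -big_split mulr_sumr -sumrB /=; apply: eq_bigr => j _; ring.
by rewrite sumr_ge0 // => i _; rewrite sumr_ge0 // => j _; rewrite sqr_ge0.
Qed.

(* Cauchy-Schwarz, using that the noise operator is symmetric and that its square
   is the noise operator of correlation [(1 - eps) ^+ 2] *)
Lemma noise_form_doubling (eps : T -> R) A :
  noise_form eps (fun w => (A w)%:R) (fun w => (A w)%:R) ^+ 2 <=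
  prob R A * noise_form (fun e => 1 - (1 - eps e) ^+ 2) (fun w => (A w)%:R) (fun w => (A w)%:R).
Proof.
pose f (w : cfg) : R := (A w)%:R.
pose g (w : cfg) : R := \sum_w' f w' * \prod_e nk (eps e) (w e) (w' e).
have -> : noise_form eps f f = \sum_w f w * g w.
  apply: eq_bigr => w _; rewrite /g mulr_sumr; apply: eq_bigr => w' _; rewrite mulrA //.
apply: le_trans (sum_sqr_CS f g) _.
have -> : \sum_w f w ^+ 2 = \sum_w f w.
  by apply: eq_bigr => w _; rewrite /f; case: (A w); rewrite ?expr0n ?expr1n.
rewrite /prob /mean -/(f _) -mulrA; apply: ler_wpM2l; first by rewrite sumr_ge0 // => w _; rewrite ler0n.
rewrite le_eqVlt; apply/orP; left; apply/eqP.
under eq_bigr do rewrite expr2 big_distrlr /=.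
rewrite exchange_big mulr_sumr /=; apply: eq_bigr => w1 _.
rewrite exchange_big mulr_sumr /=; apply: eq_bigr => w2 _.
under eq_bigr do rewrite mulrACA.
rewrite -mulr_sumr mulrCA; congr (_ * _).
rewrite card_cfg -exprVn -prodr_const -big_split /=.
under [RHS]eq_bigr do rewrite -noise_kernel_comp.
transitivity (\sum_(w : cfg) \prod_e (nk (eps e) (w1 e) (w e) * nk (eps e) (w e) (w2 e))).
  by apply: eq_bigr => w _; rewrite -big_split; apply: eq_bigr => e _; rewrite noise_kernelC.
rewrite -(bigA_distr_bigA (fun e s => nk (eps e) (w1 e) s * nk (eps e) s (w2 e))) /=.
by apply: eq_bigr => e _; rewrite big_bool addrC.
Qed.

Lemma noise_form_ge0 (eps : T -> R) A B : (forall e, 0 <= eps e <= 1) ->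
  0 <= noise_form eps (fun w => (A w)%:R) (fun w => (B w)%:R).
Proof.
move=> e01; rewrite sumr_ge0 // => w _; rewrite sumr_ge0 // => w' _.
by rewrite !mulr_ge0 ?ler0n // prodr_ge0 // => e _; apply: noise_kernel_ge0.
Qed.

(** Each use of [noise_form_doubling] squares the correlation; after [J] of them it is at most 1/4
    and [noise_form_indicator] applies. The bound is p^(1 + 2^(-J-1)) with powers cleared. *)
Lemma noise_form_pow (J : nat) (eps : T -> R) A :
  (forall e, 0 <= eps e <= 1) -> (forall e, (1 - eps e) ^+ (2 ^ J) <= 1 / 4) ->
  noise_form eps (fun w => (A w)%:R) (fun w => (A w)%:R) ^+ (2 ^ J.+1) <=
    prob R A ^+ (2 ^ J.+1).+1.
Proof.
elim: J eps => [|J IH] eps e01 e4.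
  by apply: noise_form_indicator => e; have := e4 e; have /andP[? ?] := e01 e; rewrite expn0 expr1; lra.
rewrite expnS exprM.
have p0 := prob_ge0 R A.
apply: le_trans (_ : (prob R A * noise_form (fun e => 1 - (1 - eps e) ^+ 2)
    (fun w => (A w)%:R) (fun w => (A w)%:R)) ^+ (2 ^ J.+1) <= _).
  rewrite lerXn2r ?nnegrE ?sqr_ge0 //; last exact: noise_form_doubling.
  rewrite mulr_ge0 // noise_form_ge0 // => e; have /andP[a1 a2] := e01 e.
  have : 0 <= (1 - eps e) ^+ 2 <= 1 by rewrite sqr_ge0 expr_le1 //; lra.
  by move=> /andP[? ?]; apply/andP; split; lra.
rewrite exprMn mul2n -addnn -addnS exprD; apply: ler_wpM2l; first exact: exprn_ge0.
apply: IH => e; have /andP[a1 a2] := e01 e.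
  have : 0 <= (1 - eps e) ^+ 2 <= 1 by rewrite sqr_ge0 expr_le1 //; lra.
  by move=> /andP[? ?]; apply/andP; split; lra.
have := e4 e; rewrite expnS exprM.
by congr (_ ^+ _ <= _); ring.
Qed.

End SmallSetExpansion.

(** With M = 2^(J+1), [noise_form_pow] bounds the M-th power of the form by p^M p, so p <= eta^M
    suffices. Since [J] depends on [eps] only, the threshold is uniform in [T] and [d]. *)
Lemma small_set_expansion (R : realType) (eps eta : R) : 0 < eps <= 1 -> 0 < eta ->
  exists2 p0 : R, 0 < p0 & forall (T : finType) (d : T -> R) (A : {ffun T -> bool} -> bool),
    (forall e, eps <= d e <= 1) -> prob R A <= p0 ->
    noise_form d (fun w => (A w)%:R) (fun w => (A w)%:R) <= eta * prob R A.
Proof.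
move=> /andP[e0 e1] eta0.
have [J HJ] : exists J, (1 - eps) ^+ (2 ^ J) <= 1 / 4.
  have [N HN] : exists N, (1 - eps) ^+ N <= 1 / 4.
    (* Bernoulli's inequality and (1 - eps)^N (1 + eps)^N <= 1 bound the power by 1 / (1 + N eps),
       where N eps >= 4. *)
    pose N := Num.bound (4 / eps); exists N.
    have /archi_boundP HN : 0 <= 4 / eps by rewrite divr_ge0 // ltW.
    have B : (1 - eps) ^+ N * (1 + N%:R * eps) <= 1.
      apply: le_trans (_ : (1 - eps) ^+ N * (1 + eps) ^+ N <= 1).
        by apply: ler_wpM2l; [rewrite exprn_ge0 //; lra|apply: bernoulli_le; exact: ltW].
      by rewrite -exprMn expr_le1 //; nra.
    have P0 : 0 <= (1 - eps) ^+ N by rewrite exprn_ge0 //; lra.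
    have H4 : 4 <= N%:R * eps.
      by move: HN; rewrite ltr_pdivrMr // => /ltW.
    by set P := _ ^+ _ in B P0 *; set E := N%:R * eps in B H4; nra.
  exists N; apply: le_trans HN; apply: ler_wiXn2l; [lra|lra|].
  exact: ltnW (ltn_expl N _).
exists (eta ^+ (2 ^ J.+1)); first exact: exprn_gt0.
move=> T d A dE pA.
have d01 e : 0 <= d e <= 1 by have /andP[? ?] := dE e; apply/andP; split; lra.
have p0 := prob_ge0 R A.
have K := @noise_form_pow R T J d A d01.
rewrite -(@ler_pXn2r _ (2 ^ J.+1)) ?nnegrE ?noise_form_ge0 ?expn_gt0 ?(ltW eta0) //; last first.
  by rewrite mulr_ge0 // ltW.
apply: le_trans (K _) _.
  move=> e; apply: le_trans HJ; have /andP[? ?] := dE e.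
  by rewrite lerXn2r ?nnegrE //; lra.
rewrite [(eta * _) ^+ _]exprMn [prob R A ^+ _.+1]exprS; apply: ler_wpM2r => //; exact: exprn_ge0.
Qed.

(** * Replacing the noise block by block; tilting the law of the edges *)

Section NoiseTelescope.
Variables (R : realType) (T : finType).
Local Notation cfg := {ffun T -> bool}.
Implicit Types (S : pred T) (d : T -> R) (f g h : cfg -> R).

(** Summing out the coordinates in [S], which [g] ignores, leaves only the total mass of each of
    their kernels. *)
Lemma sum_mass_eq S (K K' : T -> bool -> R) g : depends_on (predC S) g ->
  (forall e, ~~ S e -> K e =1 K' e) ->
  (forall e, S e -> K e false + K e true = K' e false + K' e true) ->
  \sum_w g w * \prod_e K e (w e) = \sum_w g w * \prod_e K' e (w e).
Proof.
move=> dg KK mm.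
suff H L : \sum_w g w * \prod_e L e (w e) = #|{: cfg}|%:R *
    ((\prod_(e | S e) ((L e false + L e true) / 2)) *
     mean (fun w => g w * \prod_(e | ~~ S e) L e (w e))).
  rewrite !H; congr (_ * (_ * _)); first by apply: eq_bigr => e Se; rewrite mm.
  by apply: eq_mean => w; congr (_ * _); apply: eq_bigr => e Se; rewrite KK.
have -> : \prod_(e | S e) ((L e false + L e true) / 2) =
    mean (fun w : cfg => \prod_(e | S e) L e (w e)).
  transitivity (mean (fun w : cfg => \prod_e (if S e then L e (w e) else 1))); last first.
    by apply: eq_mean => w; rewrite -big_mkcond.
  rewrite (mean_prod (fun e s => if S e then L e s else 1)) big_mkcond; apply: eq_bigr => e _.
  by case: (S e) => //; field.
rewrite -(@mean_indep _ _ S).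
- rewrite /mean mulrC divfK ?gt_eqF ?card_cfg_gt0 //; apply: eq_bigr => w _.
  by rewrite mulrCA; congr (_ * _); rewrite (bigID S).
- by move=> w w' ww; apply: eq_bigr => e /ww ->.
- move=> w w' ww; congr (_ * _); first exact: dg.
  by apply: eq_bigr => e Se; rewrite ww.
Qed.

Lemma noise_formC d g h : noise_form d g h = noise_form d h g.
Proof.
rewrite /noise_form exchange_big; apply: eq_bigr => w _; apply: eq_bigr => w' _.
by rewrite [g w' * _]mulrC; congr (_ * _); apply: eq_bigr => e _; rewrite noise_kernelC.
Qed.

(** At every noise level the second copy is uniform given the first, so the level on coordinates
    that [h] ignores can be changed freely. *)
Lemma noise_form_indep S d d' g h : depends_on (predC S) h ->
  (forall e, ~~ S e -> d e = d' e) -> noise_form d g h = noise_form d' g h.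
Proof.
move=> dh dd; apply: eq_bigr => w _.
under eq_bigr do rewrite -mulrA; under [RHS]eq_bigr do rewrite -mulrA.
rewrite -!mulr_sumr; congr (_ * _).
apply: (@sum_mass_eq S (fun e => noise_kernel (d e) (w e)) (fun e => noise_kernel (d' e) (w e))) => //.
  by move=> e /dd -> t.
by move=> e _; rewrite !noise_kernel_mass.
Qed.

Lemma noise_formDl d f g h :
  noise_form d (fun w => f w - g w) h = noise_form d f h - noise_form d g h.
Proof.
rewrite -sumrB; apply: eq_bigr => w _; rewrite -sumrB; apply: eq_bigr => w' _.
by rewrite !mulrBl.
Qed.

Lemma noise_formDr d f g h :
  noise_form d h (fun w => f w - g w) = noise_form d h f - noise_form d h g.
Proof. by rewrite noise_formC noise_formDl !(noise_formC d h). Qed.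

Lemma le_noise_form d (A B : cfg -> bool) : (forall e, 0 <= d e <= 1) ->
  (forall w, A w -> B w) ->
  noise_form d (fun w => (A w)%:R) (fun w => (A w)%:R) <=
  noise_form d (fun w => (B w)%:R) (fun w => (B w)%:R).
Proof.
move=> d01 AB; apply: ler_sum => w _; apply: ler_sum => w' _; apply: ler_wpM2r.
  by rewrite prodr_ge0 // => e _; apply: noise_kernel_ge0.
by apply: ler_pM; rewrite ?ler0n // ler_nat; [case: (A w) (AB w)|case: (A w') (AB w')] => // ->.
Qed.

Lemma noise_form_full g h : noise_form (fun=> 1) g h = mean g * mean h.
Proof.
rewrite /noise_form /mean mulrACA big_distrlr /= -invfM mulr_suml; apply: eq_bigr => w _.
rewrite mulr_suml; apply: eq_bigr => w' _; congr (_ * _).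
rewrite card_cfg -exprMn -exprVn -prodr_const; apply: eq_bigr => e _.
by rewrite /noise_kernel; field.
Qed.

(* Of the four terms obtained from [f = c - u], only [u u'] sees [S] on both sides. *)
Lemma noise_block_step S d d' (f c V : cfg -> bool) (B : R) :
  depends_on (predC S) c -> (forall w, f w = c w && ~~ V w) ->
  (forall e, 0 <= d e <= 1) -> (forall e, 0 <= d' e <= 1) ->
  (forall e, ~~ S e -> d e = d' e) ->
  noise_form d (fun w => (V w)%:R) (fun w => (V w)%:R) <= B ->
  noise_form d' (fun w => (V w)%:R) (fun w => (V w)%:R) <= B ->
  `|noise_form d (fun w => (f w)%:R) (fun w => (f w)%:R) -
    noise_form d' (fun w => (f w)%:R) (fun w => (f w)%:R)| <= B.
Proof.
move=> dc fE d01 d'01 dd VB V'B.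
pose u w := c w && V w.
have fu w : (f w)%:R = (c w)%:R - (u w)%:R :> R.
  by rewrite fE /u; case: (c w); case: (V w); rewrite /= ?subrr ?subr0.
have F x : noise_form x (fun w => (f w)%:R) (fun w => (f w)%:R) =
    noise_form x (fun w => (c w)%:R) (fun w => (c w)%:R)
    - noise_form x (fun w => (u w)%:R) (fun w => (c w)%:R)
    - noise_form x (fun w => (u w)%:R) (fun w => (c w)%:R)
    + noise_form x (fun w => (u w)%:R) (fun w => (u w)%:R) :> R.
  rewrite (_ : (fun w => (f w)%:R) = fun w => (c w)%:R - (u w)%:R); last exact/funext.
  rewrite noise_formDl !noise_formDr [noise_form x (fun w => (c w)%:R) (fun w => (u w)%:R)]noise_formC; ring.
have dc' : depends_on (predC S) (fun w => (c w)%:R : R).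
  by move=> w w' ww; rewrite (dc w w' ww).
rewrite !F !(noise_form_indep _ dc' dd).
have uV w : u w -> V w by move=> /andP[].
have := le_trans (le_noise_form d01 uV) VB.
have := le_trans (le_noise_form d'01 uV) V'B.
have := noise_form_ge0 u u d01; have := noise_form_ge0 u u d'01.
move=> *; rewrite ler_norml; apply/andP; split; lra.
Qed.

(** Hybrid argument: the level is 1 on blocks below [j] and [eps] on the others, which interpolates
    between the given noise and an independent copy. [c j] ignores block [j]; all dependence on it
    is in [V j]. *)
Lemma noise_telescope (eps eta : R) (blk : T -> nat) (J : nat) (f : cfg -> bool)
  (c V : nat -> cfg -> bool) :
  0 <= eps <= 1 -> (forall e, (blk e < J)%N) ->
  (forall j, depends_on (predC (fun e => blk e == j)) (c j)) ->
  (forall j w, f w = c j w && ~~ V j w) ->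
  (forall j d, (forall e, eps <= d e <= 1) ->
    noise_form d (fun w => (V j w)%:R) (fun w => (V j w)%:R) <= eta * prob R (V j)) ->
  `|noise_form (fun=> eps) (fun w => (f w)%:R) (fun w => (f w)%:R) - prob R f ^+ 2| <=
    eta * \sum_(j < J) prob R (V j).
Proof.
move=> /andP[e0 e1] blkJ dc fE sse.
pose d j (e : T) : R := if (blk e < j)%N then 1 else eps.
have dE j e : eps <= d j e <= 1 by rewrite /d; case: ifP => _; rewrite ?lexx ?e1.
have d01 j e : 0 <= d j e <= 1 by have /andP[? ->] := dE j e; rewrite andbT (le_trans e0).
pose N j := noise_form (d j) (fun w => (f w)%:R) (fun w => (f w)%:R) : R.
suff H m : `|N 0%N - N m| <= eta * \sum_(j < m) prob R (V j).
  have := H J; rewrite /N (_ : d J = fun=> 1); last by apply/funext => e; rewrite /d blkJ.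
  by rewrite noise_form_full -expr2 (_ : d 0%N = fun=> eps).
elim: m => [|m IH]; first by rewrite subrr normr0 big_ord0 mulr0.
rewrite big_ord_recr mulrDr /= -(subrK (N m) (N 0%N)) -addrA.
apply: le_trans (ler_normD _ _) _; apply: lerD => //.
apply: (noise_block_step (dc m) (fE m)) => //; try exact: sse.
by move=> e /= /negbTE ne; rewrite /d [in RHS]ltnS [in RHS]leq_eqVlt ne.
Qed.

End NoiseTelescope.

(** * Tilting the edge law towards the cheap weight *)

Section Tilt.
Variables (R : realType) (T : finType) (S : pred T) (delta : R).
Local Notation cfg := {ffun T -> bool}.
Hypothesis delta01 : 0 <= delta <= 1.

(* density of the law under which an edge of [S] takes the value [false], that is
   the weight a, with probability [(1 + delta) / 2] *)
Definition tilt (w : cfg) : R := \prod_(e | S e) (if w e then 1 - delta else 1 + delta).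

Lemma mean_tiltX j : mean (fun w => tilt w ^+ j) =
  (((1 + delta) ^+ j + (1 - delta) ^+ j) / 2) ^+ #|S|.
Proof.
pose K e s : R := if S e then (if s then 1 - delta else 1 + delta) ^+ j else 1.
rewrite (eq_mean (G := fun w => \prod_e K e (w e))) => [|w].
  rewrite mean_prod -prodr_const [RHS]big_mkcond; apply: eq_bigr => e _; rewrite /K unfold_in.
  by case: (S e) => //; field.
by rewrite /tilt -prodrXl big_mkcond.
Qed.

Lemma exp1D_le (u : R) N : 0 <= u -> N%:R * u <= 1 ->
  (1 + u) ^+ N <= 1 + N%:R * u + (N%:R * u) ^+ 2.
Proof.
move=> u0; elim: N => [|N IH]; first by rewrite expr0 mul0r expr0n !addr0.
rewrite -natr1 exprS => Nu.
have n0 : 0 <= N%:R :> R by rewrite ler0n.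
apply: le_trans (ler_wpM2l _ (IH _)) _; [lra|nra|].
set n : R := N%:R in Nu n0 *.
rewrite -subr_ge0 [X in 0 <= X](_ : _ = u ^+ 2 * (n + 1 - n * (n * u))); last by ring.
by rewrite mulr_ge0 ?sqr_ge0 //; nra.
Qed.

(** Put x = #|S| delta^2. In the expansion of the fourth power the orders 0 and 1 in x cancel, the
    latter as 6 - 12 + 6 = 0. The fourth moment leaves 50 x^2 and the second 6 x^2. *)
Lemma tilt_fourth_moment : 7 * (#|S|%:R * delta ^+ 2) <= 1 ->
  mean (fun w => (tilt w - 1) ^+ 4) <= 56 * (#|S|%:R * delta ^+ 2) ^+ 2.
Proof.
move=> x7.
have -> : mean (fun w => (tilt w - 1) ^+ 4) = mean (fun w => tilt w ^+ 4)
    - 4 * mean (fun w => tilt w ^+ 3) + 6 * mean (fun w => tilt w ^+ 2)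
    - 4 * mean (fun w => tilt w ^+ 1) + mean (fun _ : cfg => 1).
  by rewrite -!meanZ -meanB -meanD -meanB -meanD; apply: eq_mean => w; ring.
rewrite mean_cst !mean_tiltX.
have -> : ((1 + delta) ^+ 1 + (1 - delta) ^+ 1) / 2 = 1 by field.
have -> : ((1 + delta) ^+ 2 + (1 - delta) ^+ 2) / 2 = 1 + delta ^+ 2 by field.
have -> : ((1 + delta) ^+ 3 + (1 - delta) ^+ 3) / 2 = 1 + 3 * delta ^+ 2 by field.
have -> : ((1 + delta) ^+ 4 + (1 - delta) ^+ 4) / 2 =
  1 + (6 * delta ^+ 2 + (delta ^+ 2) ^+ 2) by field.
rewrite expr1n; have y0 := sqr_ge0 delta.
have y1 : delta ^+ 2 <= 1 by rewrite expr_le1 //; case/andP: delta01.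
have N0 : 0 <= #|S|%:R :> R by rewrite ler0n.
have N1 : #|S|%:R <= #|S|%:R ^+ 2 :> R.
  by rewrite -natrX ler_nat; case: #|S| => // n; rewrite leq_pmull.
(* The linear coefficient 6 must stay exact for the cancellation; it is written 7 - 1. *)
have E4 : (1 + (6 * delta ^+ 2 + (delta ^+ 2) ^+ 2)) ^+ #|S| <=
    1 + #|S|%:R * (7 * delta ^+ 2) + (#|S|%:R * (7 * delta ^+ 2)) ^+ 2 -
    #|S|%:R * delta ^+ 2 + (#|S|%:R * delta ^+ 2) ^+ 2.
  apply: le_trans (exp1D_le _ _) _.
  - by rewrite addr_ge0 // ?sqr_ge0 // mulr_ge0.
  - by nra.
  - set N : R := #|S|%:R in x7 N0 N1 *; set y := delta ^+ 2 in x7 y0 y1 *.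
    have H1 : N * y ^+ 2 <= (N * y) ^+ 2.
      by have := ler_wpM2r (sqr_ge0 y) N1; lra.
    have H2 : (N * (6 * y + y ^+ 2)) ^+ 2 <= (N * (7 * y)) ^+ 2.
      have Z : 0 <= 6 * y + y ^+ 2 <= 7 * y by apply/andP; split; nra.
      have /andP[Z0 Z1] := Z; apply: lerXn2r; last exact: ler_wpM2l.
        by rewrite nnegrE mulr_ge0.
      by rewrite nnegrE mulr_ge0 // (le_trans Z0).
    by move: H1 H2; lra.
have E2 : (1 + delta ^+ 2) ^+ #|S| <= 1 + #|S|%:R * delta ^+ 2 + (#|S|%:R * delta ^+ 2) ^+ 2.
  by apply: exp1D_le => //; nra.
have E3 : 1 + #|S|%:R * (3 * delta ^+ 2) <= (1 + 3 * delta ^+ 2) ^+ #|S|.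
  by apply: bernoulli_le; rewrite mulr_ge0.
by move: E4 E2 E3; nra.
Qed.

(** Pointwise, y = [tilt w - 1] satisfies y <= lambda or y <= y^4 / lambda^3. *)
Lemma tilt_prob_le (A : cfg -> bool) (lambda : R) : 0 < lambda ->
  mean (fun w => tilt w * (A w)%:R) <=
    (1 + lambda) * prob R A + mean (fun w => (tilt w - 1) ^+ 4) / lambda ^+ 3.
Proof.
move=> l0; rewrite -meanZ [X in _ + X]mulrC -meanZ -meanD; apply: ler_mean => w.
have P0 : 0 <= (lambda ^+ 3)^-1 * (tilt w - 1) ^+ 4.
  by apply: mulr_ge0; [rewrite invr_ge0 exprn_ge0 // ltW|exact: exprn_even_ge0].
case: (A w); last by rewrite !mulr0 add0r.
rewrite !mulr1; have [|yl] := lerP (tilt w - 1) lambda; first by move: P0; lra.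
suff : tilt w - 1 <= (lambda ^+ 3)^-1 * (tilt w - 1) ^+ 4 by lra.
rewrite mulrC ler_pdivlMr ?exprn_gt0 // (exprS _ 3); apply: ler_wpM2l; first lra.
by rewrite lerXn2r ?nnegrE; lra.
Qed.

(* Coupling: independently with probability [delta] each edge of [S] is turned
   from [true] to [false]; this carries the uniform law to the tilted one. *)
Lemma tilt_flip_gain (A B : cfg -> bool) (c : cfg -> nat) :
  (forall w, A w -> exists D : pred T,
     [/\ forall e, D e -> S e && w e, (c w <= #|D|)%N &
       forall w' : cfg, (forall e, w' e -> w e) -> (exists2 e, D e & ~~ w' e) -> B w']) ->
  prob R A - mean (fun w => tilt w * (B w)%:R) <= mean (fun w => (1 - delta) ^+ c w).
Proof.
have /andP[d0 d1] := delta01.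
move=> H; pose k e s t : R :=
  if S e then (if s then (if t then 1 - delta else delta) else (~~ t)%:R) else (s == t)%:R.
have k0 e s t : 0 <= k e s t by rewrite /k; case: (S e) s t => -[] []; rewrite ?ler0n //; lra.
have tiltE w' : tilt w' = \sum_(w : cfg) \prod_e k e (w e) (w' e).
  rewrite -(bigA_distr_bigA (fun e s => k e s (w' e))) /= /tilt big_mkcond.
  apply: eq_bigr => e _; rewrite big_bool /k; case: (S e); case: (w' e) => /=; ring.
have -> : mean (fun w => tilt w * (B w)%:R) =
    mean (fun w : cfg => \sum_(w' : cfg) (B w')%:R * \prod_e k e (w e) (w' e)).
  rewrite /mean; congr (_ / _); rewrite exchange_big /=; apply: eq_bigr => w' _.
  by rewrite mulrC tiltE mulr_sumr.
rewrite -meanB; apply: ler_mean => w.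
have P0 w' : 0 <= \prod_e k e (w e) (w' e) by rewrite prodr_ge0.
have [Aw|_] := boolP (A w); last first.
  rewrite sub0r; apply: (@le_trans _ _ 0); last by rewrite exprn_ge0 //; lra.
  by rewrite oppr_le0 sumr_ge0 // => w' _; rewrite mulr_ge0.
have [D [DS cD DB]] := H w Aw.
have -> : (true%:R : R) = \sum_(w' : cfg) \prod_e k e (w e) (w' e).
  rewrite -(bigA_distr_bigA (fun e => k e (w e))) /= big1 // => e _.
  by rewrite big_bool /k; case: (S e); case: (w e) => /=; ring.
rewrite -sumrB.
(* If [B] fails after the flips, no edge of [D] was switched, and this event factorises over the
   edges. *)
apply: (@le_trans _ _ (\sum_(w' : cfg) \prod_e (k e (w e) (w' e) * (D e ==> w' e)%:R))).
  apply: ler_sum => w' _; rewrite -[X in X - _]mul1r -mulrBl big_split /=.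
  have [Bw|nB] := boolP (B w').
    by rewrite subrr mul0r mulr_ge0 // prodr_ge0.
  rewrite subr0 mul1r.
  have [/forallP le|/forallPn[e]] := boolP [forall e, w' e ==> w e]; last first.
    rewrite negb_imply => /andP[w'e we].
    suff -> : \prod_e k e (w e) (w' e) = 0 by rewrite mul0r.
    by rewrite (bigD1 e) //= /k (negbTE we) w'e /=; case: (S e); rewrite mul0r.
  rewrite [X in _ * X]big1 ?mulr1 // => e _.
  have [De|//] := boolP (D e); have [//|w'e] := boolP (w' e).
  by case/negP: nB; apply: DB; [move=> e'; apply/implyP|exists e].
rewrite -(bigA_distr_bigA (fun e t => k e (w e) t * (D e ==> t)%:R)) /=.
have -> : \prod_e \sum_(t : bool) k e (w e) t * (D e ==> t)%:R = (1 - delta) ^+ #|D|.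
  rewrite -prodr_const [RHS]big_mkcond; apply: eq_bigr => e _; rewrite big_bool /k unfold_in.
  case De : (D e) => /=.
    by have /andP[-> ->] := DS e De; rewrite /=; ring.
  by case: (S e); case: (w e) => /=; ring.
by apply: ler_wiXn2l => //; lra.
Qed.

End Tilt.

(** * Duality and box crossings *)

Definition vertex : Type := (nat * nat)%type.
Definition edge_key : Type := (nat * nat * bool)%type.

(** For adjacent points: the lower left end of their edge, and whether it is vertical. *)
Definition ek (u v : vertex) : edge_key := (minn u.1 v.1, minn u.2 v.2, u.1 == v.1).

Fixpoint step_parity (P : pred edge_key) (x : vertex) (s : seq vertex) : bool :=
  if s is y :: s' then P (ek x y) (+) step_parity P y s' else false.

Lemma step_parity_addb (P Q : pred edge_key) x s :
  step_parity (fun c => P c (+) Q c) x s = step_parity P x s (+) step_parity Q x s.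
Proof.
elim: s x => //= y s IH x; rewrite IH.
by case: (P _); case: (Q _); case: (step_parity P y s); case: (step_parity Q y s).
Qed.

Lemma eq_step_parity (P Q : pred edge_key) x s : P =1 Q -> step_parity P x s = step_parity Q x s.
Proof. by move=> PQ; elim: s x => //= y s IH x; rewrite IH PQ. Qed.

(** [P] is the coboundary of [phi] modulo 2, so the count telescopes along the walk. *)
Lemma step_parity_potential (e : rel vertex) (P : pred edge_key) (phi : pred vertex) x s :
  path e x s -> (forall u v, e u v -> P (ek u v) = phi u (+) phi v) ->
  step_parity P x s = phi x (+) phi (last x s).
Proof.
move=> + H; elim: s x => [|y s IH] x /=; first by rewrite addbb.
by move=> /andP[xy /IH ->]; rewrite (H _ _ xy) addbA -(addbA (phi x)) addbb addbF.
Qed.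

Lemma step_parity_has (e : rel vertex) (P : pred edge_key) x s :
  path e x s -> step_parity P x s -> exists u v, e u v /\ P (ek u v).
Proof.
elim: s x => //= y s IH x /andP[xy ys]; case Pxy : (P (ek x y)); last exact: IH.
by move=> _; exists x, y.
Qed.

Section Duality.
Variable k : nat.

(* edges of the box [0,k] x [0,k-1] except those of its two vertical sides *)
Definition in_box (c : edge_key) : bool :=
  let: (x, y, d) := c in if d then (0 < x < k)%N && (y.+1 < k)%N else (x < k)%N && (y < k)%N.

Definition open_step (omega : edge_key -> bool) : rel vertex :=
  fun u v => [&& adj u v, in_box (ek u v) & ~~ omega (ek u v)].

Definition box_crossed (omega : edge_key -> bool) : Prop :=
  exists x s, [/\ path (open_step omega) x s, x.1 = 0%N & (last x s).1 = k].

Lemma eq_box_crossed omega omega' : (forall c, in_box c -> omega c = omega' c) ->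
  box_crossed omega -> box_crossed omega'.
Proof.
move=> E [x [s [p x0 sk]]]; exists x, s; split=> //.
apply: sub_path p => u v /and3P[uv ub uo]; apply/and3P; split=> //.
by rewrite -E.
Qed.

(* The dual box, reflected in the diagonal, is the box itself: the dual of the edge
   [c] becomes the edge [dual_key c]. *)
Definition dual_key (c : edge_key) : edge_key :=
  let: (x, y, d) := c in if d then (y.+1, x.-1, true) else (y, x, false).

Lemma dual_keyK c : in_box c -> dual_key (dual_key c) = c.
Proof. by case: c => [[x y] []] //= /andP[/andP[x0 _] _]; rewrite prednK. Qed.

Lemma in_box_dual c : in_box c -> in_box (dual_key c).
Proof. by case: c => [[x y] []] /=; lia. Qed.

Lemma adj_cases (u v : vertex) (P : vertex -> vertex -> Prop) : adj u v ->
  (forall x y, P (x, y) (x, y.+1)) -> (forall x y, P (x, y) (x.+1, y)) ->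
  (forall u v, P u v -> P v u) -> P u v.
Proof.
case: u v => [x y] [x' y'] /orP[] /andP[/eqP /= E /orP[] /eqP /= F] V H C; subst=> //.
- by apply/C/V.
- by apply/C/H.
Qed.

Lemma ekC u v : ek u v = ek v u.
Proof. by rewrite /ek minnC (minnC u.2) eq_sym. Qed.

Lemma ek_vert x y : ek (x, y) (x, y.+1) = (x, y, true).
Proof. by rewrite /ek /= minnn eqxx; congr (_, _, _); lia. Qed.

Lemma ek_hor x y : ek (x, y) (x.+1, y) = (x, y, false).
Proof. by rewrite /ek /= minnn; congr (_, _, _); lia. Qed.

(* Let [H v] be the parity of the number of edges of the dual crossing met by the
   horizontal half-line to the left of [v]. Along the primal crossing [H] changes
   exactly at the edges crossed by the dual one, and it goes from 0 to 1. *)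
Lemma no_dual_crossings omega : (0 < k)%N ->
  box_crossed omega -> box_crossed (fun c => ~~ omega (dual_key c)) -> False.
Proof.
move=> k0 [x0 [s [ps x00 sk]]] [y0 [t [pt y00 tk]]].
pose left (v : vertex) (c : edge_key) := [&& c.1.1 == v.2, (c.1.2 < v.1)%N & ~~ c.2].
pose H v := step_parity (left v) y0 t.
pose C c := step_parity (fun c' => c' == dual_key c) y0 t.
have Hstep u v : open_step omega u v -> C (ek u v) = H u (+) H v.
  move=> /and3P[uv + _]; apply: (adj_cases
    (P := fun u v => in_box (ek u v) -> C (ek u v) = H u (+) H v) uv)
    => [x y|x y|{uv}u {}v IH]; last by rewrite ekC addbC.
  - rewrite ek_vert /= => /andP[/andP[xgt xk] yk].
    (* The two half-lines and the dual edge together bound the set of dual points with first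
       coordinate [y.+1] and second below [x]. Neither end of the dual walk lies in it. *)
    have Z : step_parity (fun c => (c == (y.+1, x.-1, true)) (+)
        (left (x, y) c (+) left (x, y.+1) c)) y0 t = false.
      rewrite (step_parity_potential (phi := fun v => (v.1 == y.+1) && (v.2 < x)%N) pt).
        by rewrite y00 tk /= [k == _]gtn_eqF.
      move=> u' v' /andP[uv' _]; apply: (adj_cases (P := fun u v =>
        (ek u v == (y.+1, x.-1, true)) (+) (left (x, y) (ek u v) (+) left (x, y.+1) (ek u v)) =
        ((u.1 == y.+1) && (u.2 < x)%N) (+) ((v.1 == y.+1) && (v.2 < x)%N)) uv')
        => [X Y|X Y|u1 v1 IH]; last by rewrite ekC [RHS]addbC.
        by rewrite ek_vert /left /= !xpair_eqE; lia.
      by rewrite ek_hor /left /= !xpair_eqE; lia.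
    rewrite !step_parity_addb in Z.
    rewrite -[C _]/(step_parity (fun c => c == (y.+1, x.-1, true)) y0 t).
    by move: Z; rewrite -!/(H _); case: (step_parity _ _ _); case: (H _); case: (H _).
  - rewrite ek_hor /= => /andP[xk yk].
    rewrite /C /H -step_parity_addb; apply: eq_step_parity => -[[X Y] d].
    by rewrite /left /= !xpair_eqE; case: d => /=; lia.
have HE : step_parity (C : pred edge_key) x0 s.
  rewrite (step_parity_potential ps Hstep).
  have -> : H x0 = false.
    rewrite /H (eq_step_parity (Q := pred0)); last by move=> c; rewrite /left x00 ltn0 andbF.
    by elim: (t) (y0) => //= z t' IH y; rewrite IH.
  have yk : ((last x0 s).2 < k)%N.
    move: ps sk x00; case/lastP: s => [|s z]; first by move=> _ /= E xE; lia.
    rewrite rcons_path last_rcons => /andP[_ /and3P[+ + _]] zk _; move: zk.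
    move: (last x0 s) z => u z.
    case: u z => [X Y] [X' Y'] /= ->; rewrite /adj /ek /=; case: (X == k) => /=; lia.
  have -> : H (last x0 s) = step_parity (left (k, (last x0 s).2)) y0 t by rewrite /H /left sk.
  (* From the right side the half-line spans the whole width, so it separates the two ends of the
     dual walk. *)
  rewrite (step_parity_potential (phi := fun v => (v.1 <= (last x0 s).2)%N) pt).
    by rewrite y00 tk /= leqNgt yk.
  move=> u v /and3P[uv + _]; apply: (adj_cases (P := fun u v => in_box (ek u v) ->
    left (k, (last x0 s).2) (ek u v) = (u.1 <= (last x0 s).2)%N (+) (v.1 <= (last x0 s).2)%N) uv)
    => [X Y|X Y|u1 v1 IH]; last by rewrite ekC addbC.
    by rewrite ek_vert /left /=; lia.
  by rewrite ek_hor /left /=; lia.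
(* An edge of the primal walk whose dual is used by the dual walk would be both open and closed. *)
have [u [v [/and3P[_ uvb uvo] Cuv]]] := step_parity_has ps HE.
have [u' [v' [/and3P[_ _ +] /eqP E]]] := step_parity_has pt Cuv.
by rewrite E dual_keyK // (negbTE uvo).
Qed.

Definition shiftx (m : nat) (omega : edge_key -> bool) : edge_key -> bool :=
  fun c => omega ((c.1.1 + m)%N, c.1.2, c.2).

(** Otherwise the walk would produce an open crossing. Invariant: it is left of column [L], or its
    position is reached inside the box by open edges from the left side. The open walk restarts at
    each visit to column [L] and is complete at column [L + k], so edges of the vertical sides do
    not occur in it. *)
Lemma walk_box_crossed (L : nat) omega x s : (0 < k)%N ->
  path adj x s -> all (fun u => u.2 < k)%N (x :: s) ->
  (x.1 <= L)%N -> (L + k <= (last x s).1)%N -> ~ box_crossed (shiftx L omega) ->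
  exists2 c, c \in pairmap ek x s &
    [/\ omega c, (L <= c.1.1)%N & in_box (c.1.1 - L, c.1.2, c.2)%N].
Proof.
move=> k0 + + xL + nB.
pose reach (v : vertex) := (L <= v.1 <= L + k)%N /\ exists y t,
  [/\ path (open_step (shiftx L omega)) y t, y.1 = 0%N & last y t = (v.1 - L, v.2)%N].
have reachL (v : vertex) : v.1 = L -> reach v.
  move=> vL; split; first by rewrite vL leqnn leq_addr.
  by exists (0%N, v.2), [::]; rewrite /= vL subnn.
pose inv v := (v.1 < L)%N \/ reach v.
have : inv x by move: xL; rewrite leq_eqVlt => /orP[/eqP/reachL|]; [right|left].
elim: s x {xL} => [|y s IH] x ix /=.
  move=> _ _ Lx; case: ix => [xL|[/andP[a1 a2] [y [t [p y0 lt]]]]]; first by lia.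
  case: nB; exists y, t; split=> //; rewrite lt /=; lia.
move=> /andP[xy ys] /and3P[xk yk sk] lastk.
have [[wc cL cb]|N] := pselect [/\ omega (ek x y), (L <= (ek x y).1.1)%N &
    in_box ((ek x y).1.1 - L, (ek x y).1.2, (ek x y).2)%N].
  by exists (ek x y); rewrite ?inE ?eqxx.
suff iy : inv y.
  have [|||c cin cP] := IH y iy; rewrite //= ?yk //.
  by exists c; rewrite ?inE ?cin ?orbT.
case: ix => [xL|[/andP[Lx xLk] [z [t [p z0 lt]]]]].
  have : (y.1 <= L)%N by move: xy; rewrite /adj; lia.
  by rewrite leq_eqVlt => /orP[/eqP/reachL|]; [right|left].
have {}xLk : (x.1 < L + k)%N.
  rewrite ltn_neqAle xLk andbT; apply/eqP => E; apply: nB; exists z, t; split=> //.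
  by rewrite lt /= E addKn.
have [yL|Ly] := ltnP y.1 L; first by left.
move: Ly; rewrite leq_eqVlt => /orP[/eqP/esym/reachL|Ly]; [by right|right].
split; first by move: xy; rewrite /adj; lia.
exists z, (rcons t (y.1 - L, y.2)%N); rewrite last_rcons; split=> //.
rewrite rcons_path p lt /=.
have E : ek (x.1 - L, x.2)%N (y.1 - L, y.2)%N = ((ek x y).1.1 - L, (ek x y).1.2, (ek x y).2)%N.
  by rewrite /ek /=; congr (_, _, _); lia.
have eL : (L <= (ek x y).1.1)%N by rewrite /ek /= leq_min Lx ltnW.
have b : in_box ((ek x y).1.1 - L, (ek x y).1.2, (ek x y).2)%N.
  case: (x) (y) xy xk yk xLk Lx Ly => [X Y] [X' Y'] /=.
  by rewrite /ek /= /adj /=; have [->|NE] := eqVneq X X'; lia.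
apply/and3P; split; first by move: xy Lx Ly; rewrite /adj /=; lia.
  by rewrite E.
have S : shiftx L omega ((ek x y).1.1 - L, (ek x y).1.2, (ek x y).2)%N = omega (ek x y).
  by case: (ek x y) eL => -[X Y] d /= eL; rewrite /shiftx /= subnK.
by rewrite E S; apply/negP => wc; apply: N.
Qed.

End Duality.

(** * Windows of the strip *)

Section Environment.
Variable n : nat.
Implicit Types (w : config n) (e : E n) (c : edge_key).

Definition ekey e : edge_key := let: (x, y, d) := val e in (nat_of_ord x, nat_of_ord y, d).

Definition valid_key c : bool :=
  let: (x, y, d) := c in [&& (x <= n)%N, (y < n)%N & if d then (y.+1 < n)%N else (x < n)%N].

(* [false] also on keys that are not edges of the box *)
Definition env w : edge_key -> bool := fun c => [exists e, (ekey e == c) && w e].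

Lemma ekey_inj : injective ekey.
Proof.
move=> [[[x y] d] xy] [[[x' y'] d'] xy']; rewrite /ekey /= => -[] /val_inj xx /val_inj yy dd.
by apply: val_inj; rewrite /= xx yy dd.
Qed.

Lemma ekey_valid e : valid_key (ekey e).
Proof. by case: e => [[[x y] []] xy] /=; rewrite -ltnS !ltn_ord; move: xy => /= ->. Qed.

Lemma valid_keyP c : valid_key c -> exists e, ekey e = c.
Proof.
case: c => [[x y] d] /and3P[xn yn dn].
have ok : edge_okb (Ordinal (xn : (x < n.+1)%N), Ordinal yn, d) by case: d dn.
by exists (exist (fun e : 'I_n.+1 * 'I_n * bool => is_true (edge_okb e)) _ ok).
Qed.

Lemma env_ekey w e : env w (ekey e) = w e.
Proof.
apply/existsP/idP => [[e' /andP[/eqP/ekey_inj -> //]]|we].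
by exists e; rewrite eqxx.
Qed.

(** Inverse of [ekey] on valid keys, with default [e] because [E n] is empty for [n = 0]. *)
Definition edge_of e c : E n := odflt e [pick e' | ekey e' == c].

Lemma edge_ofK e c : valid_key c -> ekey (edge_of e c) = c.
Proof.
move=> /valid_keyP[e' e'c]; rewrite /edge_of; case: pickP => [e1 /eqP //|/(_ e')].
by rewrite e'c eqxx.
Qed.

Lemma edge_joins_ek e (u v : vertex) : adj u v -> edge_joins e u v = (ekey e == ek u v).
Proof.
case: u v => [x y] [x' y']; case: e => [[[X Y] d] ok].
rewrite /edge_joins /edge_p1 /edge_p2 /ekey /ek /adj /= => uv.
by case: d ok => /= _; rewrite !xpair_eqE /=; lia.
Qed.

Lemma ffun_comp_inj (phi : E n -> E n) : injective phi ->
  injective (fun w : config n => [ffun e => w (phi e)] : config n).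
Proof.
move=> phiI w w' /ffunP E; apply/ffunP => e.
by have := E (invF phiI e); rewrite !ffunE f_invF.
Qed.

Definition shifty (m : nat) (omega : edge_key -> bool) : edge_key -> bool :=
  fun c => omega (c.1.1, (c.1.2 + m)%N, c.2).

Definition row e : nat := (ekey e).1.2.
Definition column e : nat := (ekey e).1.1.

Definition strip_key k c : bool :=
  let: (x, y, d) := c in [&& (x <= n)%N, (y < k)%N & if d then (y.+1 < k)%N else (x < n)%N].

Lemma strip_key_valid k m x y d : (m + k <= n)%N -> strip_key k (x, y, d) ->
  valid_key (x, (y + m)%N, d).
Proof. by case: d => /=; lia. Qed.

Definition strip_path k (x : vertex) s : bool :=
  [&& path adj x s, all (fun u : vertex => (u.1 <= n)%N && (u.2 < k)%N) (x :: s),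
      x.1 == 0%N & (last x s).1 == n].

Lemma ek_strip k (u v : vertex) : adj u v -> (u.1 <= n)%N && (u.2 < k)%N ->
  (v.1 <= n)%N && (v.2 < k)%N -> strip_key k (ek u v).
Proof. by case: u v => [x y] [x' y']; rewrite /adj /ek /=; have [->|N] := eqVneq x x'; lia. Qed.

Lemma walk_keys_strip k (x : vertex) s c : path adj x s ->
  all (fun u : vertex => (u.1 <= n)%N && (u.2 < k)%N) (x :: s) ->
  c \in pairmap ek x s -> strip_key k c.
Proof.
elim: s x => //= y s IH x /andP[xy ys] /and3P[xk yk sk].
rewrite inE => /orP[/eqP ->|]; first exact: ek_strip.
by apply: IH => //; rewrite /= yk.
Qed.

Lemma strip_path_keys k x s c : strip_path k x s -> c \in pairmap ek x s -> strip_key k c.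
Proof. by move=> /and4P[p a _ _]; apply: walk_keys_strip. Qed.

End Environment.

(** * Passage times and crossings of windows *)

Section PassageTimes.
Variables (R : realType) (a b : R) (n : nat).
Implicit Types (w : config n) (e : E n) (P : pred R).

Definition ptime (omega : edge_key -> bool) (x : vertex) s : R :=
  \sum_(c <- pairmap ek x s) wt a b (omega c).

Lemma step_wt_env w u v : adj u v -> valid_key n (ek u v) ->
  step_wt a b w u v = wt a b (env w (ek u v)).
Proof.
move=> uv /valid_keyP[e eE]; rewrite /step_wt (bigD1 e) /=; last by rewrite edge_joins_ek // eE.
rewrite -eE env_ekey big1 ?addr0 // => e' /andP[]; rewrite edge_joins_ek // -eE.
by move=> /eqP/ekey_inj ->; rewrite eqxx.
Qed.

Definition up (m : nat) (u : vertex) : vertex := (u.1, (u.2 + m)%N).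

Lemma adj_up m u v : adj (up m u) (up m v) = adj u v.
Proof. by rewrite /adj /up /=; lia. Qed.

Lemma ek_up m u v : ek (up m u) (up m v) = ((ek u v).1.1, ((ek u v).1.2 + m)%N, (ek u v).2).
Proof. by rewrite /ek /up /=; congr (_, _, _); lia. Qed.

Lemma path_up m x s : path adj (up m x) (map (up m) s) = path adj x s.
Proof. by elim: s x => //= y s IH x; rewrite adj_up IH. Qed.

Lemma passage_up k m w x s : (m + k <= n)%N -> strip_path n k x s ->
  passage a b w (map (up m) (x :: s)) = ptime (shifty m (env w)) x s.
Proof.
move=> mk /and4P[+ + _ _]; rewrite /passage /ptime.
elim: s x => [|y s IH] x; first by rewrite /= !big_nil.
move=> /= /andP[xy ys] /and3P[xk yk sk]; rewrite !big_cons /= -[in RHS]IH //=; last by rewrite yk.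
congr (_ + _); have ok := ek_strip xy xk yk.
rewrite step_wt_env ?adj_up // ek_up //.
by case: (ek x y) ok => [[X Y] d] /= ok; apply: (strip_key_valid (k := k)).
Qed.

Definition window_crossed k P m w : bool :=
  `[< exists x s, strip_path n k x s /\ P (ptime (shifty m (env w)) x s) >].

(** A window sticking out of the box can be moved to the nearest one inside without losing the path.
    Paths are then translated to start at row 0, so that all windows share the same set of paths. *)
Lemma PkP k : (0 < k <= n)%N -> forall w (t : R),
  (exists2 p, Pk n k p & passage a b w p = t) <->
  (exists m : 'I_(n - k).+1, exists x s, strip_path n k x s /\ t = ptime (shifty m (env w)) x s).
Proof.
move=> /andP[k0 kn] w t; split.
  move=> [p [x [s [pE [px [pin [x0 [ls [M pM]]]]]]]] <-].
  have [m [mnk mP]] : exists m : nat, (m <= n - k)%N /\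
      all (fun u : nat * nat => (m <= u.2 < m + k)%N) p.
    case: M pM => [M|M] pM.
      exists (minn M (n - k)); split; first by rewrite geq_minr.
      apply/allP => u up; have := allP pM u up; have := allP pin u up; rewrite /=; lia.
    exists 0%N; split => //.
    by apply/allP => u up; have := allP pM u up; have := allP pin u up; rewrite /=; lia.
  pose down (u : vertex) : vertex := (u.1, u.2 - m)%N.
  have pud : map (up m) (map down p) = p.
    rewrite -map_comp -[RHS]map_id; apply/eq_in_map => u up.
    by have := allP mP u up; case: u {up} => X Y; rewrite /up /= => H; congr pair; lia.
  have sp : strip_path n k (down x) (map down s).
    apply/and4P; split.
    - by rewrite -(path_up m); move: pud; rewrite pE /= => -[-> ->].
    - rewrite -[_ :: _]/(map down (x :: s)) -pE all_map; apply/allP => u up /=.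
      have := allP mP u up; have := allP pin u up; rewrite /=; lia.
    - by rewrite /= x0.
    - by rewrite last_map /= ls.
  have mo : (m < (n - k).+1)%N by rewrite ltnS.
  exists (Ordinal mo), (down x), (map down s); split=> //=.
  by rewrite -(passage_up (k := k)) //; [rewrite -/(map down (x :: s)) -pE pud|lia].
move=> [m [x [s [sp ->]]]]; have mk : (m + k <= n)%N by have := ltn_ord m; lia.
have /and4P[ps /allP as_ /eqP x0 /eqP ls] := sp.
exists (map (up m) (x :: s)); last exact: passage_up sp.
exists (up m x), (map (up m) s); split=> //; split; first by rewrite path_up.
split.
  apply/allP => u /mapP[v vs ->]; have := as_ v vs; rewrite /up /=; lia.
split; first exact: x0.
split; first by rewrite last_map.
exists (Posz m); apply/allP => u /mapP[v vs ->]; have := as_ v vs; rewrite /up /=; lia.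
Qed.

Lemma straight_strip_path k : (0 < k)%N -> (0 < n)%N ->
  strip_path n k (0%N, 0%N) [seq (i, 0%N) | i <- iota 1%N n].
Proof.
move=> k0 n0; apply/and4P; split=> //.
- have H j l : path adj (j, 0%N) [seq (i, 0%N) | i <- iota j.+1 l].
    by elim: l j => //= l IH j; rewrite IH andbT /adj /=; lia.
  exact: H.
- apply/allP => u; rewrite inE => /orP[/eqP -> //|/mapP[i]].
  by rewrite mem_iota => H ->; rewrite /= k0 andbT; lia.
- by case: n n0 => // n' _; rewrite last_map -[n'.+1]addn1 iotaD last_cat /= add1n addn1.
Qed.

Lemma ptime_form omega x s : exists i j, ptime omega x s = i%:R * a + j%:R * b.
Proof.
rewrite /ptime; elim: (pairmap ek x s) => [|c l [i [j IH]]].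
  by exists 0%N, 0%N; rewrite big_nil !mul0r addr0.
rewrite big_cons IH; case: (omega c) => /=.
  by exists i, j.+1; rewrite -natr1; ring.
by exists i.+1, j; rewrite -natr1; ring.
Qed.

Lemma seq_min (s : seq R) (y : R) : y \in s -> exists2 z, z \in s & {in s, forall t, z <= t}.
Proof.
elim: s y => // x s IH _ _; case: s IH => [|y s] IH.
  by exists x; rewrite ?inE // => t; rewrite inE => /eqP ->.
have [z zs zm] := IH y (mem_head _ _).
exists (Num.min x z); first by rewrite inE; case: leP => _; rewrite ?eqxx ?zs ?orbT.
move=> t; rewrite inE => /orP[/eqP ->|/zm]; first by rewrite ge_min lexx.
by move=> zt; rewrite ge_min zt orbT.
Qed.

(** Only finitely many values [i * a + j * b] lie below a given bound, so the infimum defining [tau]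
    is attained. *)
Lemma discrete_min (V : R -> Prop) : 0 < a -> a < b -> (exists t, V t) ->
  (forall t, V t -> exists i j, t = i%:R * a + j%:R * b) ->
  exists2 t, V t & forall t', V t' -> t <= t'.
Proof.
move=> a0 ab [t0 Vt0] VE; have b0 : 0 < b by apply: lt_trans ab.
have [N HN] : exists N : nat, t0 < N%:R * a.
  exists (Num.bound `|t0 / a|).
  by rewrite -ltr_pdivrMr //; apply: le_lt_trans (ler_norm _) _; apply: archi_boundP; apply: normr_ge0.
pose L := [seq t <- [seq i%:R * a + j%:R * b | i <- iota 0%N N, j <- iota 0%N N] | `[< V t >]].
have inL t : V t -> t <= t0 -> t \in L.
  move=> Vt tt0; rewrite mem_filter; apply/andP; split; first exact/asboolP.
  have [i [j tE]] := VE t Vt; apply/allpairsP; exists (i, j); split=> //=.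
    rewrite mem_iota add0n -(ltr_nat R) -(ltr_pM2r a0); apply: le_lt_trans HN.
    by apply: le_trans tt0; rewrite tE lerDl mulr_ge0 // ltW.
  rewrite mem_iota add0n -(ltr_nat R) -(ltr_pM2r a0); apply: le_lt_trans HN.
  apply: le_trans tt0; apply: (@le_trans _ _ (j%:R * b)); first by rewrite ler_wpM2l // ltW.
  by rewrite tE lerDr mulr_ge0 // ltW.
have [z] := seq_min (inL t0 Vt0 (lexx _)).
rewrite mem_filter => /andP[/asboolP Vz zin] zm; exists z => // t Vt.
have [/(inL t Vt)|tt0] := leP t t0; first exact: zm.
by apply: le_trans (ltW tt0); apply: zm; apply: inL.
Qed.

(** Since the infimum is a minimum over paths, this holds for both [< q] and [<= q]. *)
Lemma tau_crossed k w (P : pred R) : 0 < a -> a < b -> (0 < k <= n)%N ->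
  (forall s t, s <= t -> P t -> P s) ->
  P (tau a b n k w) = [exists m : 'I_(n - k).+1, window_crossed k P m w].
Proof.
move=> a0 ab kn Pdown; have /andP[k0 kn'] := kn; have n0 := leq_trans k0 kn'.
pose V := [set passage a b w p | p in Pk n k]%classic.
have VE (t : R) : V t <-> exists m : 'I_(n - k).+1, exists x s,
  strip_path n k x s /\ t = ptime (shifty m (env w)) x s := PkP kn w t.
have [t Vt tmin] : exists2 t, V t & forall t', V t' -> t <= t'.
  apply: discrete_min => //.
    exists (ptime (shifty 0 (env w)) (0%N, 0%N) [seq (i, 0%N) | i <- iota 1%N n]).
    apply/VE; exists ord0, (0%N, 0%N), [seq (i, 0%N) | i <- iota 1%N n].
    by split=> //; apply: straight_strip_path.
  by move=> t /VE[m [x [s [_ ->]]]]; apply: ptime_form.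
have -> : tau a b n k w = t.
  apply/eqP; rewrite eq_le; apply/andP; split; first by apply: ge_inf => //; exists t => t' /tmin.
  by apply: lb_le_inf; [exists t|move=> t' /tmin].
apply/idP/existsP => [Pt|[m /asboolP[x [s [sp Ps]]]]].
  have [m [x [s [sp tE]]]] := (VE t).1 Vt.
  by exists m; apply/asboolP; exists x, s; rewrite -tE.
by apply: Pdown Ps; apply: tmin; apply/VE; exists m, x, s.
Qed.

Lemma shifty_env_local k m w w' c : (forall e, (m <= row e < m + k)%N -> w e = w' e) ->
  strip_key n k c -> shifty m (env w) c = shifty m (env w') c.
Proof.
move=> ww; case: c => [[x y] d] ck; rewrite /shifty /=.
apply: eq_existsb => e; have [eE|//] := eqVneq; rewrite ww //.
by rewrite /row eE /=; case: d ck {eE} => /=; lia.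
Qed.

Lemma eq_window_crossed k P m m' w w' :
  (forall c, strip_key n k c -> shifty m (env w) c = shifty m' (env w') c) ->
  window_crossed k P m w = window_crossed k P m' w'.
Proof.
move=> H; have E x s : strip_path n k x s ->
    ptime (shifty m (env w)) x s = ptime (shifty m' (env w')) x s.
  by move=> sp; apply: eq_big_seq => c /(strip_path_keys sp) ck; rewrite H.
by apply/asboolP/asboolP => -[x [s [sp Ps]]]; exists x, s; split; rewrite -?E // E.
Qed.

Lemma window_depends k P m :
  depends_on (fun e => m <= row e < m + k)%N (window_crossed k P m).
Proof. by move=> w w' ww; apply: eq_window_crossed => c; apply: shifty_env_local. Qed.

(* Moving all edges up by one row, cyclically, maps the window at [m] to the next one. *)
Lemma window_prob_succ k P m : (m.+1 + k <= n)%N ->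
  prob R (window_crossed k P m) = prob R (window_crossed k P m.+1).
Proof.
move=> mk.
(* Horizontal edges cycle through [n] rows and vertical ones through [n - 1], hence the [+ d]. *)
pose up1 (c : edge_key) : edge_key := let: (x, y, d) := c in
  (x, if (y.+1 + d < n)%N then y.+1 else 0%N, d).
pose phi (e : E n) := edge_of e (up1 (ekey e)).
have phiE e : ekey (phi e) = up1 (ekey e).
  apply: edge_ofK; have := ekey_valid e; case: (ekey e) => [[x y] []] /=; case: ifP; lia.
have phiI : injective phi.
  move=> e e' /(congr1 (@ekey n)); rewrite !phiE => E; apply: ekey_inj.
  have := ekey_valid e; have := ekey_valid e'; move: E.
  case: (ekey e) (ekey e') => [[x y] d] [[x' y'] d'] /= [xx + dd]; subst x' d'.
  case: d => /=; case: ifP; case: ifP => A B C /and3P[? ? ?] /and3P[? ? ?]; congr (_, _, _); lia.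
rewrite /prob -[LHS](mean_inj _ (ffun_comp_inj phiI)); apply: eq_mean => w /=.
congr (nat_of_bool _)%:R; apply: eq_window_crossed => -[[x y] d] ck.
have [|e eE] := @valid_keyP n (x, (y + m)%N, d); first by apply: (strip_key_valid (k := k)) ck; lia.
rewrite {1}/shifty /= -eE env_ekey ffunE -env_ekey phiE eE /shifty /up1 addnS ifT //.
by case: d ck {eE} => /=; lia.
Qed.

(** * Square boxes inside a window *)

Section Boxes.
Variables (k m : nat).
Hypotheses (k0 : (0 < k)%N) (mk : (m + k <= n)%N).

Definition box_bad (i : nat) w : bool :=
  ~~ `[< box_crossed k (shiftx (i * k) (shifty m (env w))) >].

Definition of_box i c : edge_key := ((c.1.1 + i * k)%N, (c.1.2 + m)%N, c.2).
Definition to_box i c : edge_key := ((c.1.1 - i * k)%N, (c.1.2 - m)%N, c.2).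
Definition box_edge i e : bool :=
  [&& (i * k <= column e)%N, (m <= row e)%N & in_box k (to_box i (ekey e))].

Lemma of_box_valid i c : (i.+1 * k <= n)%N -> in_box k c -> valid_key n (of_box i c).
Proof. by rewrite mulSn; case: c => [[x y] []] /=; lia. Qed.

Lemma to_boxK i e : box_edge i e -> of_box i (to_box i (ekey e)) = ekey e.
Proof.
move=> /and3P[]; rewrite /column /row /of_box /to_box; case: (ekey e) => [[x y] d] /= xi ym _.
by rewrite !subnK.
Qed.

Lemma of_boxK i c : to_box i (of_box i c) = c.
Proof. by case: c => [[x y] d]; rewrite /of_box /to_box /= !addnK. Qed.

Lemma box_bad_depends i : depends_on (fun e => column e %/ k == i)%N (box_bad i).
Proof.
move=> w w' ww; congr (~~ _).
have E c : in_box k c -> shiftx (i * k) (shifty m (env w)) c = shiftx (i * k) (shifty m (env w')) c.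
  move=> cb; rewrite /shiftx /shifty /=; apply: eq_existsb => e.
  have [eE|//] := eqVneq; rewrite ww // /column eE /= addnC divnMDl // divn_small ?addn0 ?eqxx //.
  by case: c cb {eE} => [[x y] []] /=; lia.
by apply/asboolP/asboolP; apply: eq_box_crossed => c cb; rewrite E.
Qed.

(* The box is crossed with probability at most 1/2 because the involution
   complementing the dual configuration maps crossed configurations to bad ones. *)
Lemma box_bad_prob i : (i.+1 * k <= n)%N -> 1 / 2 <= prob R (box_bad i).
Proof.
move=> ik.
pose psi (e : E n) := edge_of e (of_box i (dual_key (to_box i (ekey e)))).
have psiE e : box_edge i e -> ekey (psi e) = of_box i (dual_key (to_box i (ekey e))).
  by move=> /and3P[_ _ eb]; apply: edge_ofK; apply: of_box_valid => //; apply: in_box_dual.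
have psib e : box_edge i e -> box_edge i (psi e).
  move=> eb; rewrite /box_edge /column /row psiE // of_boxK; have /and3P[_ _ cb] := eb.
  by apply/and3P; split; [exact: leq_addl|exact: leq_addl|exact: in_box_dual].
have psiK e : box_edge i e -> psi (psi e) = e.
  move=> eb; apply: ekey_inj; rewrite psiE ?psib // psiE // of_boxK (dual_keyK (k := k)) ?to_boxK //.
  by case/and3P: eb.
pose sigma (w : config n) : config n := [ffun e => if box_edge i e then ~~ w (psi e) else w e].
have sigmaK : involutive sigma.
  move=> w; apply/ffunP => e; rewrite !ffunE; have [eb|//] := boolP (box_edge i e).
  by rewrite psib // psiK // negbK.
have envS (w1 : config n) (c : edge_key) : in_box k c -> shiftx (i * k) (shifty m (env (sigma w1))) c =
    ~~ shiftx (i * k) (shifty m (env w1)) (dual_key c).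
  move=> cb; have [e eE] := valid_keyP (of_box_valid ik cb).
  have eb : box_edge i e.
    by rewrite /box_edge /column /row eE of_boxK cb andbT !leq_addl.
  rewrite -[LHS]/(env (sigma w1) (of_box i c)) -[in RHS]/(env w1 (of_box i (dual_key c))).
  by rewrite -eE env_ekey ffunE eb -env_ekey psiE // eE of_boxK.
have imp (w2 : config n) : ~~ box_bad i (sigma w2) -> box_bad i w2.
  rewrite /box_bad negbK => /asboolP cs; apply/negP => /asboolP cw.
  by apply: (no_dual_crossings k0 cw); apply: eq_box_crossed cs => c cb; rewrite envS.
have : prob R (fun w => ~~ box_bad i w) <= prob R (box_bad i).
  rewrite /prob -[leLHS](mean_inj _ (inv_inj sigmaK)).
  by apply: (@le_prob R _ (fun w => ~~ box_bad i (sigma w))).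
rewrite probC; lra.
Qed.

(** The boxes use disjoint columns, so the mean factorises, each factor being at most
    [1 - delta / 2]. *)
Lemma mean_bad_boxes (delta : R) : 0 <= delta <= 1 ->
  mean (fun w : config n => (1 - delta) ^+ (\sum_(i < n %/ k) box_bad i w)) <=
  (1 - delta / 2) ^+ (n %/ k).
Proof.
move=> /andP[d0 d1].
have E w : (1 - delta) ^+ (\sum_(i < n %/ k) box_bad i w) =
    \prod_(i < n %/ k) (1 - delta * (box_bad i w)%:R).
  rewrite -prodrXr; apply: eq_bigr => i _.
  by case: (box_bad i w); rewrite ?expr1 ?expr0 ?mulr1 ?mulr0 ?subr0.
rewrite (eq_mean E) (@mean_indep_prod R _ _ _ _ (fun (i : 'I_(n %/ k)) e => column e %/ k == i)%N).
- rewrite -[X in _ <= _ ^+ X]card_ord -prodr_const; apply: ler_prod => i _.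
  rewrite meanB meanZ mean_cst -/(prob R (box_bad i)).
  have ik : (i.+1 * k <= n)%N.
    by apply: leq_trans (leq_divM n k); rewrite leq_mul2r ltn_ord orbT.
  have := prob_le1 R (box_bad i); have := box_bad_prob ik.
  by move=> *; apply/andP; split; nra.
- exact: index_enum_uniq.
- by move=> i _ w w' ww; rewrite (box_bad_depends ww).
- by move=> i j e _ _ /eqP ei /eqP ej; apply: val_inj; rewrite /= -ei -ej.
Qed.

Definition window_edge : pred (E n) := fun e => (m <= row e < m + k)%N.

(** Coupling with [D] the edges of weight b on a path of time at most [q]: switching any of them
    brings the time below [q], and there are at least as many as bad boxes. *)
Lemma window_flip_le (q delta : R) : a < b -> 0 <= delta <= 1 ->
  prob R (window_crossed k (fun t => t <= q) m) -
    mean (fun w => tilt window_edge delta w * (window_crossed k (fun t => t < q) m w)%:R) <=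
  (1 - delta / 2) ^+ (n %/ k).
Proof.
move=> ab d01.
apply: le_trans (mean_bad_boxes d01).
apply: (tilt_flip_gain (S := window_edge) d01) => w /asboolP[x [s [sp tq]]].
pose D : pred (E n) := fun e =>
  [&& window_edge e, w e & (column e, (row e - m)%N, (ekey e).2) \in pairmap ek x s].
have Dkey c : c \in pairmap ek x s -> shifty m (env w) c ->
    exists2 e, D e & ekey e = (c.1.1, (c.1.2 + m)%N, c.2).
  move=> cin; have := strip_path_keys sp cin; case: c cin => [[X Y] d] cin ck.
  have [e eE] := valid_keyP (strip_key_valid mk ck).
  rewrite /shifty /= -eE env_ekey => we; exists e => //.
  apply/and3P; split=> //; rewrite /window_edge /row /column ?eE /= ?addnK //.
  by case: d ck {cin eE} => /=; lia.
exists D; split; first by move=> e /and3P[-> ->].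
  have -> : (\sum_(i < n %/ k) box_bad i w = size [seq i <- iota 0%N (n %/ k) | box_bad i w])%N.
    rewrite size_filter -sum1_count (_ : iota 0%N (n %/ k) = index_iota 0 (n %/ k)).
      by rewrite big_mkord [RHS]big_mkcond; apply: eq_bigr => i _; case: box_bad.
    by rewrite /index_iota subn0.
  (* Each edge is sent to the index of its box; by [walk_box_crossed] every bad box is hit. *)
  rewrite cardE -(size_map (fun e => column e %/ k)%N).
  apply: uniq_leq_size; first by rewrite filter_uniq // iota_uniq.
  move=> i; rewrite mem_filter mem_iota add0n /= => /andP[/asboolPn bad ilt].
  have /and4P[ps pin /eqP x0 /eqP ls] := sp.
  have strip : all (fun u : vertex => u.2 < k)%N (x :: s) by apply: sub_all pin => u /andP[].
  have := walk_box_crossed k0 ps strip _ _ bad.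
  rewrite x0 ls => /(_ (leq0n _)) [|c cin [wc ic cb]].
    by rewrite -mulSnr; apply: leq_trans (leq_divM n k); rewrite leq_mul2r ilt orbT.
  have [e De eE] := Dkey c cin wc; apply/mapP; exists e; first by rewrite mem_enum.
  rewrite /column eE /= -(subnK ic) addnC divnMDl // divn_small ?addn0 //.
  by case: c cb {cin wc ic eE} => [[X Y] []] /=; lia.
move=> w' w'w [e De w'e]; apply/asboolP; exists x, s; split=> //; apply: lt_le_trans tq.
have ew c : wt a b (shifty m (env w') c) <= wt a b (shifty m (env w) c).
  rewrite /shifty /env; case: existsP => [[e' /andP[eE /w'w we]]|_] /=.
    by case: existsP => // N; case: N; exists e'; rewrite eE.
  by case: existsP => _ //=; apply: ltW.
have /and3P[/andP[me _] we cin] := De.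
(* One occurrence of the switched edge gives strictness; no other term increases. *)
rewrite /ptime (big_rem _ cin) [ltRHS](big_rem _ cin) /=; apply: ltr_leD.
  have -> : shifty m (env w') (column e, (row e - m)%N, (ekey e).2) = w' e.
    rewrite /shifty /= subnK // -[RHS]env_ekey; congr (env _ _).
    by rewrite /column /row; case: (ekey e) => [[]].
  have -> : shifty m (env w) (column e, (row e - m)%N, (ekey e).2) = w e.
    rewrite /shifty /= subnK // -[RHS]env_ekey; congr (env _ _).
    by rewrite /column /row; case: (ekey e) => [[]].
  by rewrite we (negbTE w'e).
by apply: ler_sum => c _.
Qed.

(** The coupling compares [<= q] under the uniform law with [< q] under the tilted one, and the
    fourth moment returns to the uniform law. *)
Lemma window_tail_le (q delta lambda : R) : a < b -> 0 <= delta <= 1 -> 0 < lambda ->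
  7 * ((n.+1 * k * 2)%:R * delta ^+ 2) <= 1 ->
  prob R (window_crossed k (fun t => t <= q) m) <=
    (1 + lambda) * prob R (window_crossed k (fun t => t < q) m) +
    56 * ((n.+1 * k * 2)%:R * delta ^+ 2) ^+ 2 / lambda ^+ 3 + (1 - delta / 2) ^+ (n %/ k).
Proof.
move=> ab d01 l0 N7.
pose S := window_edge.
have cardS : (#|S| <= n.+1 * k * 2)%N.
  pose L := [seq (p, d) | p <- [seq (x, y) | x <- iota 0%N n.+1, y <- iota m k], d <- [:: true; false]].
  have inL (p : nat * nat) d : (m <= p.2 < m + k)%N -> valid_key n (p, d) -> (p, d) \in L.
    case: p => x y yk /and3P[xn _ _]; apply/allpairsP; exists ((x, y), d).
    split=> //; last by case: (d).
    by apply/allpairsP; exists (x, y); rewrite !mem_iota add0n ltnS.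
  have -> : (n.+1 * k * 2 = size L)%N by rewrite !size_allpairs !size_iota.
  rewrite cardE -(size_map (@ekey n)); apply: uniq_leq_size.
    by rewrite map_inj_uniq ?enum_uniq //; apply: ekey_inj.
  move=> c /mapP[e]; rewrite mem_enum unfold_in => eS ->.
  have := ekey_valid e; move: eS; rewrite /S /window_edge /row; case: (ekey e) => x y ym xn; exact: inL.
have SN : #|S|%:R * delta ^+ 2 <= (n.+1 * k * 2)%:R * delta ^+ 2.
  by rewrite ler_wpM2r ?sqr_ge0 // ler_nat.
have S7 : 7 * (#|S|%:R * delta ^+ 2) <= 1 by lra.
have S0 : 0 <= #|S|%:R * delta ^+ 2 by rewrite mulr_ge0 ?sqr_ge0 ?ler0n.
have T1 := tilt_prob_le S delta (window_crossed k (fun t => t < q) m) l0.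
have T2 := tilt_fourth_moment d01 S7.
have T3 := window_flip_le q ab d01.
have T4 : mean (fun w : config n => (tilt S delta w - 1) ^+ 4) / lambda ^+ 3 <=
    56 * ((n.+1 * k * 2)%:R * delta ^+ 2) ^+ 2 / lambda ^+ 3.
  apply: ler_wpM2r; first by rewrite invr_ge0 exprn_ge0 // ltW.
  apply: le_trans T2 _; apply: ler_wpM2l => //.
  by apply: lerXn2r => //; rewrite nnegrE // (le_trans S0).
by move: T1 T3 T4; rewrite -/S; lra.
Qed.

End Boxes.
End PassageTimes.

(** * Estimates over all windows *)

Section Windows.
Variables (R : realType) (a b : R) (n k : nat).
Hypothesis kn : (0 < k <= n)%N.
Implicit Types (P : pred R) (w : config n).

Local Notation win P m := (@window_crossed R a b n k P m).
Local Notation none P := (fun w : config n => ~~ [exists m : 'I_(n - k).+1, win P m w]).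

(** Windows whose positions agree modulo [k] have disjoint rows and are independent, so each of the
    [k] classes contributes at most 1/c. *)
Lemma sum_window_prob P (c : R) : 0 < c -> c <= prob R (none P) ->
  \sum_(m < (n - k).+1) prob R (win P m) <= k%:R * c^-1.
Proof.
move=> c0 cle; have /andP[k0 kn'] := kn.
rewrite (partition_big (fun m : 'I_(n - k).+1 => Ordinal (ltn_pmod m k0)) predT) //=.
apply: (@le_trans _ _ (\sum_(r < k) c^-1)); last by rewrite sumr_const card_ord mulr_natl.
apply: ler_sum => r _.
apply: (@sum_prob_le_none R _ _ _ (fun (m : 'I_(n - k).+1) e => (m <= row e < m + k)%N)) c0 _.
- by move=> m _; apply: window_depends.
- move=> i j e /eqP/(congr1 val) /= ir /eqP/(congr1 val) /= jr ie je; apply: val_inj => /=.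
  move: (divn_eq i k) (divn_eq j k); rewrite ir jr => iE jE.
  have [//|NE] := eqVneq (i %/ k)%N (j %/ k)%N; first by move=> ij; rewrite iE ij -jE.
  move: NE; rewrite neq_ltn => /orP[] lt.
    have := leq_mul2r k (i %/ k).+1 (j %/ k); rewrite lt orbT mulSn; lia.
  have := leq_mul2r k (j %/ k).+1 (i %/ k); rewrite lt orbT mulSn; lia.
- apply: le_trans cle _; apply: le_prob => w; apply: contraNN => /existsP[m /andP[_ wm]].
  by apply/existsP; exists m.
Qed.

Lemma window_prob_eq P m : (m + k <= n)%N -> prob R (win P m) = prob R (win P 0).
Proof.
elim: m => // m IH mk; rewrite -window_prob_succ //; apply: IH; lia.
Qed.

Lemma window_prob_le P (c : R) : 0 < c -> c <= prob R (none P) ->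
  (n - k).+1%:R * prob R (win P 0) <= k%:R * c^-1.
Proof.
move=> c0 cle; apply: le_trans (sum_window_prob c0 cle).
rewrite (eq_bigr (fun=> prob R (win P 0))) => [|m _].
  by rewrite sumr_const card_ord mulr_natl.
by apply: window_prob_eq; have := ltn_ord m; have /andP[] := kn; lia.
Qed.

Lemma atom_prob_le (q c delta lambda : R) : 0 < a -> a < b -> 0 < c ->
  c <= prob R (fun w => ~~ (tau a b n k w < q)) -> 0 <= delta <= 1 -> 0 < lambda ->
  7 * ((n.+1 * k * 2)%:R * delta ^+ 2) <= 1 ->
  prob R (fun w => tau a b n k w <= q) - prob R (fun w => tau a b n k w < q) <=
    lambda * (k%:R * c^-1) + n%:R *
    (56 * ((n.+1 * k * 2)%:R * delta ^+ 2) ^+ 2 / lambda ^+ 3 + (1 - delta / 2) ^+ (n %/ k)).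
Proof.
move=> a0 ab c0 cle d01 l0 N7; have /andP[k0 kn'] := kn.
have lt_down (s t : R) : s <= t -> t < q -> s < q by apply: le_lt_trans.
have le_down (s t : R) : s <= t -> t <= q -> s <= q by apply: le_trans.
have ltE w := tau_crossed w a0 ab (P := fun t => t < q) kn lt_down.
have leE w := tau_crossed w a0 ab (P := fun t => t <= q) kn le_down.
have cle' : c <= prob R (none (fun t => t < q)).
  by apply: le_trans cle _; apply: le_prob => w; rewrite ltE.
set err := 56 * _ / _ + _.
have err0 : 0 <= err.
  rewrite addr_ge0 ?exprn_ge0 //; last by case/andP: d01; lra.
  by apply: divr_ge0; [apply: mulr_ge0 => //; exact: sqr_ge0|rewrite exprn_ge0 // ltW].
(* When [tau = q], some window satisfies [<= q] and none [< q]; all terms of the sum are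
   nonnegative. *)
apply: (@le_trans _ _ (\sum_(m < (n - k).+1) (prob R (win (fun t => t <= q) m) -
    prob R (win (fun t => t < q) m)))).
  rewrite -(eq_bigr _ (fun m _ => meanB _ _)) -mean_sum /prob -meanB; apply: ler_mean => w.
  have mono m : win (fun t => t < q) m w -> win (fun t => t <= q) m w.
    by move=> /asboolP[x [s [sp /ltW tq]]]; apply/asboolP; exists x, s.
  have pos (m : 'I_(n - k).+1) : 0 <= (win (fun t => t <= q) m w)%:R -
      (win (fun t => t < q) m w)%:R :> R.
    by rewrite subr_ge0 ler_nat; case: (win _ m w) (mono m) => // ->.
  rewrite ltE leE; case: existsP => [[m wm]|_]; last first.
    by apply: (@le_trans _ _ 0); [rewrite sub0r oppr_le0 ler0n|apply: sumr_ge0].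
  case: existsP => [_|N]; first by rewrite subrr sumr_ge0.
  rewrite subr0 (bigD1 m) //= wm; case E : (win _ m w); first by case: N; exists m.
  by rewrite subr0 lerDl sumr_ge0.
apply: (@le_trans _ _ (\sum_(m < (n - k).+1) (lambda * prob R (win (fun t => t < q) m) + err))).
  apply: ler_sum => m _; have mk : (m + k <= n)%N.
    by move: (ltn_ord m) kn'; move: (nat_of_ord m) => u; clear; lia.
  by have := window_tail_le k0 mk q ab d01 l0 N7; rewrite /err; lra.
rewrite big_split /= -mulr_sumr; apply: lerD.
  by apply: ler_wpM2l (sum_window_prob c0 cle'); apply: ltW.
rewrite sumr_const card_ord -[err *+ _]mulr_natl; apply: ler_wpM2r => //.
by rewrite ler_nat; move: k0 kn'; clear; lia.
Qed.

(** [V j] says that a window meeting the [j]-th block of [2 * k] rows is crossed. It is rare enough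
    for small set expansion, and the probabilities of the [V j] add up to at most 2/c. *)
Lemma window_noise_le P (eps eta c p0 : R) : 0 < eps <= 1 -> 0 < eta -> 0 < c ->
  (forall (d : E n -> R) (A : config n -> bool),
    (forall e, eps <= d e <= 1) -> prob R A <= p0 ->
    noise_form d (fun w => (A w)%:R) (fun w => (A w)%:R) <= eta * prob R A) ->
  c <= prob R (none P) -> (3 * k)%:R * prob R (win P 0) <= p0 ->
  `|noise_form (fun=> eps) (fun w => (none P w)%:R) (fun w => (none P w)%:R) -
    prob R (none P) ^+ 2| <= eta * (2 * c^-1).
Proof.
move=> /andP[e0 e1] eta0 c0 sse cle p0le; have /andP[k0 kn'] := kn.
pose touch (j m : nat) := (m < j * (2 * k) + 2 * k)%N && (j * (2 * k) < m + k)%N.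
pose V j w := [exists m : 'I_(n - k).+1, touch j m && win P m w].
pose C j w := ~~ [exists m : 'I_(n - k).+1, ~~ touch j m && win P m w].
have k2 : (0 < 2 * k)%N by rewrite muln_gt0.
have T := @noise_telescope R (E n) eps eta (fun e => row e %/ (2 * k))%N n (none P) C V.
apply: le_trans (T _ _ _ _ _) _.
- by rewrite (ltW e0).
- move=> e; apply: leq_ltn_trans (leq_div _ _) _.
  by have := ekey_valid e; rewrite /row; case: (ekey e) => [[x y] d] /and3P[].
- move=> j w w' ww; congr (~~ _); apply: eq_existsb => m; case: (boolP (touch j m)) => //= tjm.
  apply: window_depends => e em; apply: ww => /=; apply/negP => /eqP ej.
  move: tjm; rewrite /touch negb_and -!leqNgt.
  move: (divn_eq (row e) (2 * k)) (ltn_pmod (row e) k2) em; rewrite ej.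
  move: (row e) (row e %% _)%N (j * (2 * k))%N (nat_of_ord m) => y z u v; clear; lia.
- move=> j w; rewrite /C /V -negb_or; congr (~~ _); apply/existsP/orP.
    move=> [m wm]; have [tm|tm] := boolP (touch j m); [right|left]; apply/existsP; exists m.
      by rewrite tm.
    by rewrite tm.
  by case=> /existsP[m /andP[_ wm]]; exists m.
- move=> j d dE; apply: sse => //; apply: le_trans p0le.
  apply: le_trans (prob_union_le R (fun m : 'I_(n - k).+1 => touch j m) (fun m => win P m)) _.
  rewrite (eq_bigr (fun=> prob R (win P 0))) => [|m _]; last first.
    by apply: window_prob_eq; move: (ltn_ord m) kn'; move: (nat_of_ord m) => u; clear; lia.
  rewrite sumr_const -[X in X <= _]mulr_natl; apply: ler_wpM2r; first exact: prob_ge0.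
  (* A block of [2 * k] rows meets fewer than [3 * k] windows. *)
  rewrite ler_nat cardE -(size_map val) -(size_iota (j * (2 * k) - k) (3 * k)).
  apply: uniq_leq_size; first by rewrite map_inj_uniq ?enum_uniq //; apply: val_inj.
  move=> m /mapP[i]; rewrite mem_enum => ti ->; have {ti} : touch j i := ti.
  by rewrite /touch mem_iota /=; move: (nat_of_ord i) (j * (2 * k))%N => u v; clear; lia.
apply: ler_wpM2l; first exact: ltW.
(* [V j] sees fewer than [4 * k] consecutive rows, so the events with [j] of one parity are
   independent. *)
have half (Q : pred nat) : (forall i j, Q i -> Q j -> (i < j)%N -> (i.+1 < j)%N) ->
    \sum_(j < n | Q j) prob R (V j) <= c^-1.
  move=> Qgap; apply: (@sum_prob_le_none R _ _ _ (fun (j : 'I_n) e =>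
    (j * (2 * k) < row e + k)%N && ((row e).+1 < j * (2 * k) + 3 * k)%N)) c0 _.
  - move=> j _ w w' ww; apply: eq_existsb => m; case: (boolP (touch j m)) => //= tjm.
    apply: window_depends => e em; apply: ww => /=.
    move: tjm em; rewrite /touch; move: (row e) (j * (2 * k))%N (nat_of_ord m) => y u v.
    by clear; lia.
  - have lt i j (e : E n) : Q i -> Q j -> (i * (2 * k) < row e + k)%N && ((row e).+1 < i * (2 * k) + 3 * k)%N ->
        (j * (2 * k) < row e + k)%N && ((row e).+1 < j * (2 * k) + 3 * k)%N -> ~~ (i < j)%N.
      move=> Qi Qj ie je; apply/negP => /(Qgap _ _ Qi Qj) ij.
      have : (i.+2 * (2 * k) <= j * (2 * k))%N by rewrite leq_mul2r ij orbT.
      rewrite !mulSn; move: ie je; move: (i * (2 * k))%N (j * (2 * k))%N (row e) => u v y.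
      by clear; lia.
    move=> i j e Qi Qj ie je; apply: val_inj; apply/eqP; rewrite eqn_leq (leqNgt i) (leqNgt j).
    by rewrite (lt _ _ _ Qi Qj ie je) (lt _ _ _ Qj Qi je ie).
  - apply: le_trans cle _; apply: le_prob => w; apply: contraNN.
    move=> /existsP[j /andP[_ /existsP[m /andP[_ wm]]]].
    by apply/existsP; exists m.
rewrite (bigID (fun j : 'I_n => odd j)) /= mulr_natl mulr2n; apply: lerD.
  by apply: (half (fun j => odd j)) => i j oi oj; rewrite leq_eqVlt => /orP[/eqP ij|//]; move: oj; rewrite -ij /= oi.
apply: (half (fun j => ~~ odd j)) => i j oi oj; rewrite leq_eqVlt => /orP[/eqP ij|//].
by move: oj; rewrite -ij /= negbK (negbTE oi).
Qed.

End Windows.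

(** * Choice of scales and error terms *)

Section Scales.
Variable R : realType.
Implicit Types (n k r : nat).

(** [r] is the integer part of the eighth root of [n]; [(k ^ 2) ^ 8 <= k ^ 22 <= n] then gives
    [k ^ 2 <= r]. *)
Lemma scale_exists n k r0 : (k ^ 22 <= n)%N -> (0 < n)%N -> (0 < k)%N -> (r0 ^ 8 <= n)%N ->
  exists r, [/\ (r0 <= r)%N, (r ^ 8 <= n)%N, (n < r.+1 ^ 8)%N & (k ^ 2 <= r)%N].
Proof.
move=> kn n0 k0 rn.
have ex : exists r, (n < r.+1 ^ 8)%N.
  exists n; apply: leq_trans (_ : n.+1 ^ 1 <= _)%N; first by rewrite expn1.
  by rewrite leq_exp2l.
case: (ex_minnP ex) => r nr rmin; exists r.
have lt8 s t : (s ^ 8 < t ^ 8)%N = (s < t)%N by rewrite ltn_exp2r.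
split=> //.
- by rewrite -ltnS -lt8; apply: leq_ltn_trans nr.
- case: r nr rmin => [|r] nr rmin; first by rewrite exp0n.
  by rewrite leqNgt; apply/negP => /rmin; rewrite ltnn.
- rewrite -ltnS -lt8; apply: leq_ltn_trans nr; apply: leq_trans kn.
  by rewrite -expnM leq_pexp2l.
Qed.

Variables (n k r : nat) (eta : R).
Hypotheses (r10 : (10 <= r)%N) (k0 : (0 < k)%N) (k2r : (k ^ 2 <= r)%N).
Hypotheses (rn : (r ^ 8 <= n)%N) (nr : (n < r.+1 ^ 8)%N) (eta0 : 0 < eta).

(** Of order n^(-7/8): n k delta^2 is about k / r^6, which is small, while n delta / k is about r /
    k, which is large. *)
Local Notation delta := ((r%:R ^+ 7)^-1 : R).

Lemma scale_r_ge : 10 <= r%:R :> R. Proof. by rewrite ler_nat. Qed.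
Lemma scale_k_ge : 1 <= k%:R :> R. Proof. by rewrite ler1n. Qed.
Lemma scale_k_le : k%:R ^+ 2 <= r%:R :> R. Proof. by rewrite -natrX ler_nat. Qed.
Lemma scale_n_ge : r%:R ^+ 8 <= n%:R :> R. Proof. by rewrite -natrX ler_nat. Qed.
Lemma scale_n_le : n%:R <= 256 * r%:R ^+ 8 :> R.
Proof.
apply: (@le_trans _ _ ((2 * r%:R) ^+ 8)); last by rewrite exprMn; have -> : 2 ^+ 8 = 256 :> R by ring.
apply: (@le_trans _ _ (r.+1%:R ^+ 8)); first by rewrite -natrX ler_nat ltnW.
apply: lerXn2r; rewrite ?nnegrE ?ler0n ?mulr_ge0 // -natrM ler_nat.
by move: r10; clear; lia.
Qed.

Lemma scale_delta01 : 0 <= delta <= 1.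
Proof.
have rho10 := scale_r_ge; have kappa1 := scale_k_ge; have kappa2 := scale_k_le.
have nu_ge := scale_n_ge; have nu_le := scale_n_le.
rewrite invr_ge0 exprn_ge0 ?ler0n //= invf_le1 ?exprn_gt0 //; last by lra.
by apply: exprn_ege1; lra.
Qed.

Lemma scale_kn : (0 < k <= n)%N.
Proof.
rewrite k0 /=; apply: leq_trans rn; apply: leq_trans (_ : r <= _)%N.
  by apply: leq_trans k2r; rewrite expnS expn1 leq_pmulr.
by rewrite -[X in (X <= _)%N]expn1 leq_pexp2l //; apply: leq_trans r10.
Qed.

(** 1024 collects the 2 directions, [n + 1 <= 2 * n] and [n <= 256 * r ^ 8]. *)
Lemma scale_edges : (n.+1 * k * 2)%:R * delta ^+ 2 <= 1024 * k%:R / r%:R ^+ 6.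
Proof.
have rho10 := scale_r_ge; have kappa1 := scale_k_ge; have kappa2 := scale_k_le.
have nu_ge := scale_n_ge; have nu_le := scale_n_le.
have rp : 0 < r%:R :> R by lra.
rewrite -exprVn -exprM exprVn ler_pdivlMr ?exprn_gt0 //.
rewrite mulrAC ler_pdivrMr ?exprn_gt0 // !natrM -natr1.
have r8 : 1 <= r%:R ^+ 8 :> R by apply: exprn_ege1; lra.
have E : 1024 * k%:R * r%:R ^+ (7 * 2) = (1024 * k%:R * r%:R ^+ 8) * r%:R ^+ 6 :> R by ring.
rewrite E; apply: ler_wpM2r; first by rewrite exprn_ge0 // ltW.
set N : R := n%:R in nu_ge nu_le *; set K : R := k%:R in kappa1 *; set r' := r%:R ^+ 8 in r8 nu_ge nu_le *.
have : (N + 1) * K <= (2 * N) * K by apply: ler_wpM2r; lra.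
have : N * K <= 256 * r' * K by apply: ler_wpM2r; lra.
lra.
Qed.

Lemma scale_edges7 : 7 * ((n.+1 * k * 2)%:R * delta ^+ 2) <= 1.
Proof.
have rho10 := scale_r_ge; have kappa1 := scale_k_ge; have kappa2 := scale_k_le.
have nu_ge := scale_n_ge; have nu_le := scale_n_le.
have rp : 0 < r%:R :> R by lra.
apply: le_trans (ler_wpM2l _ scale_edges) _; first by [].
rewrite mulrA ler_pdivrMr ?exprn_gt0 // mul1r.
have h5 : 10 ^+ 5 <= r%:R ^+ 5 :> R by apply: lerXn2r; rewrite ?nnegrE //; lra.
have kr : k%:R <= r%:R :> R by nra.
have -> : 7 * (1024 * k%:R) = k%:R * 7168 :> R by ring.
have h6 : 7168 <= r%:R ^+ 5 :> R by lra.
rewrite (exprS r%:R 5); apply: (@le_trans _ _ (r%:R * 7168)).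
  by apply: ler_wpM2r; [lra|exact: kr].
by apply: ler_wpM2l; [lra|exact: h6].
Qed.

(** Power counting: r^8 (k / r^6)^2 k^3 = k^5 / r^4, and k^5 <= k^6 <= r^3. *)
Lemma scale_tilt_error :
  n%:R * (56 * ((n.+1 * k * 2)%:R * delta ^+ 2) ^+ 2 / (eta / k%:R) ^+ 3) <=
  256 * 56 * 1024 ^+ 2 / eta ^+ 3 / r%:R.
Proof.
have rho10 := scale_r_ge; have kappa1 := scale_k_ge; have kappa2 := scale_k_le.
have nu_ge := scale_n_ge; have nu_le := scale_n_le.
have rp : 0 < r%:R :> R by lra.
have kp : 0 < k%:R :> R by lra.
have lp : 0 <= (eta / k%:R) ^+ 3 by apply: exprn_ge0; apply: divr_ge0; apply: ltW.
set x := _ * delta ^+ 2; have x0 : 0 <= x by apply: mulr_ge0; [exact: ler0n|exact: sqr_ge0].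
pose y : R := 1024 * k%:R / r%:R ^+ 6; have xy : x <= y := scale_edges.
have xy2 : x ^+ 2 <= y ^+ 2 by apply: lerXn2r; rewrite ?nnegrE // (le_trans x0 xy).
apply: (@le_trans _ _ ((256 * r%:R ^+ 8) * (56 * y ^+ 2 / (eta / k%:R) ^+ 3))).
  apply: ler_pM; [exact: ler0n| |exact: nu_le|].
    by apply: divr_ge0 => //; apply: mulr_ge0; [lra|exact: sqr_ge0].
  by apply: ler_wpM2r; [rewrite invr_ge0|apply: ler_wpM2l; [lra|]].
have k5 : k%:R ^+ 5 / r%:R ^+ 3 <= 1 :> R.
  rewrite ler_pdivrMr ?exprn_gt0 // mul1r; apply: (@le_trans _ _ ((k%:R ^+ 2) ^+ 3)).
    by rewrite -exprM; apply: ler_weXn2l.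
  by apply: lerXn2r => //; rewrite nnegrE ?exprn_ge0 // ltW.
have -> : 256 * r%:R ^+ 8 * (56 * y ^+ 2 / (eta / k%:R) ^+ 3) =
    256 * 56 * 1024 ^+ 2 / eta ^+ 3 / r%:R * (k%:R ^+ 5 / r%:R ^+ 3).
  by rewrite /y; field; rewrite !gt_eqF.
apply: ler_piMr; last exact: k5.
apply: divr_ge0; last exact: ltW.
apply: divr_ge0; last by apply: exprn_ge0; exact: ltW.
by apply: mulr_ge0; [lra|exact: sqr_ge0].
Qed.

(** The power is at most exp(-z) with z >= r / (4 k). From exp(z) >= (1 + z / 18)^18 and k^18 <= r^9
    it is at most 72^18 / r^9, which beats n <= 256 r^8. *)
Lemma scale_bad_error :
  n%:R * (1 - delta / 2) ^+ (n %/ k) <= 256 * (72 ^+ 18) / r%:R.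
Proof.
have rho10 := scale_r_ge; have kappa1 := scale_k_ge; have kappa2 := scale_k_le.
have nu_ge := scale_n_ge; have nu_le := scale_n_le.
have rp : 0 < r%:R :> R by lra.
have kp : 0 < k%:R :> R by lra.
have /andP[d0 d1] := scale_delta01.
set B := (n %/ k)%N; set z := B%:R * (delta / 2).
have zge : r%:R / (4 * k%:R) <= z.
  have nB : n%:R <= (B%:R + 1) * k%:R :> R.
    rewrite natr1 -natrM ler_nat mulSn {1}(divn_eq n k) addnC leq_add2r.
    by rewrite ltnW // ltn_pmod.
  have r7 : 10 <= r%:R ^+ 7 :> R.
    have r6 : 1 <= r%:R ^+ 6 :> R by apply: exprn_ege1; lra.
    by apply: le_trans rho10 _; rewrite (exprS r%:R 6); apply: ler_peMr => //; apply: ltW.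
  rewrite /z ler_pdivrMr ?mulr_gt0 //.
  have -> : B%:R * ((r%:R ^+ 7)^-1 / 2) * (4 * k%:R) = (2 * (B%:R * k%:R)) / r%:R ^+ 7 :> R.
    by field; rewrite gt_eqF.
  rewrite ler_pdivlMr ?exprn_gt0 // -exprS.
  have kr : k%:R <= r%:R :> R by nra.
  have r8 : r%:R * 10 <= r%:R ^+ 8 :> R by rewrite (exprS _ 7); apply: ler_wpM2l; lra.
  by move: nB nu_ge; rewrite mulrDl mul1r; lra.
have z0 : 0 <= z by rewrite mulr_ge0 ?ler0n // divr_ge0.
have bexp : (1 - delta / 2) ^+ B <= (expR z)^-1.
  have zE : - z = B%:R * - (delta / 2) by rewrite mulrN.
  rewrite -expRN zE expRM_natl; apply: lerXn2r; rewrite ?nnegrE ?expR_ge0 //; first lra.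
  exact: expR_ge1Dx.
have z18 : (r%:R / (72 * k%:R)) ^+ 18 <= expR z.
  have zE : z = 18%:R * (z / 18) by field.
  rewrite zE expRM_natl; apply: lerXn2r; rewrite ?nnegrE ?expR_ge0 //.
  apply: le_trans (expR_ge1Dx _).
  have -> : r%:R / (72 * k%:R) = r%:R / (4 * k%:R) / 18 :> R by field; rewrite gt_eqF.
  by lra.
have r9 : k%:R ^+ 18 <= r%:R ^+ 9 :> R.
  rewrite (exprM _ 2 9); apply: lerXn2r => //; rewrite nnegrE ?exprn_ge0 // ltW.
have [c c0 cE] : exists2 c : R, 0 < c & 72 ^+ 18 = c.
  by exists (72 ^+ 18) => //; apply: exprn_gt0; lra.
have zc : (1 - delta / 2) ^+ B <= c / r%:R ^+ 9.
  apply: le_trans bexp _.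
  apply: (@le_trans _ _ ((r%:R / (72 * k%:R)) ^+ 18)^-1).
    rewrite lef_pV2 ?posrE ?expR_gt0 //; apply: exprn_gt0; apply: divr_gt0 => //.
    by apply: mulr_gt0 => //; lra.
  rewrite -exprVn invf_div expr_div_n exprMn cE -mulrA; apply: ler_wpM2l; first exact: ltW.
  rewrite ler_pdivrMr ?exprn_gt0 // (exprD r%:R 9 9) mulKf //.
  by rewrite gt_eqF ?exprn_gt0.
rewrite cE; apply: (@le_trans _ _ (256 * r%:R ^+ 8 * (c / r%:R ^+ 9))); last first.
  by rewrite le_eqVlt; apply/orP; left; apply/eqP; field; rewrite gt_eqF.
by apply: ler_pM => //; apply: exprn_ge0; lra.
Qed.

(** Here (n - k) + 1 >= n / 2 >= r^2, and k^2 <= r. *)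
Lemma scale_window_error (c p : R) : 0 < c -> 0 <= p ->
  (n - k).+1%:R * p <= k%:R * c^-1 -> (3 * k)%:R * p <= 6 / c / r%:R.
Proof.
have rho10 := scale_r_ge; have kappa1 := scale_k_ge; have kappa2 := scale_k_le.
have nu_ge := scale_n_ge; have nu_le := scale_n_le.
move=> c0 p0 H.
have rp : 0 < r%:R :> R by lra.
have kp : 0 < k%:R :> R by lra.
have kr : k%:R <= r%:R :> R by nra.
have r2 : r%:R ^+ 2 * 2 <= n%:R :> R.
  apply: le_trans nu_ge; rewrite (exprD r%:R 2 6); apply: ler_wpM2l; first exact: sqr_ge0.
  have r5 : 1 <= r%:R ^+ 5 :> R by apply: exprn_ege1; lra.
  rewrite (exprS r%:R 5); apply: (@le_trans _ _ (r%:R * 1)); first by lra.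
  by apply: ler_wpM2l => //; apply: ltW.
have nk : n%:R / 2 <= (n - k).+1%:R :> R.
  have -> : (n - k).+1%:R = n%:R - k%:R + 1 :> R.
    by rewrite -[LHS]natr1 natrB //; case/andP: scale_kn.
  have : r%:R * 1 <= r%:R ^+ 2 :> R by rewrite expr2; apply: ler_wpM2l; lra.
  lra.
rewrite natrM ler_pdivlMr // ler_pdivlMr //.
have H1 : r%:R ^+ 2 * p <= k%:R * c^-1.
  by apply: le_trans H; apply: ler_wpM2r => //; lra.
have H2 : r%:R ^+ 2 * p * c <= k%:R by rewrite -ler_pdivlMr.
have : k%:R * (r%:R ^+ 2 * p * c) <= k%:R * k%:R by apply: ler_wpM2l => //; lra.
rewrite -expr2 => H3; rewrite -(ler_pM2r rp).
by move: H3 kappa2; lra.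
Qed.

End Scales.

(** * The quantile event *)

Local Open Scope classical_set_scope.
Local Open Scope ring_scope.

Section Theorem1p1.
Variable R : realType.

Lemma ProbE n (A : config n -> bool) : Prob A = prob R A.
Proof.
rewrite /Prob /prob /mean -natr_sum; congr (_%:R / _).
rewrite -sum1_card big_mkcond; apply: eq_bigr => w _.
set X := (w \in _); suff -> : X = A w by case: (A w).
by apply/idP/idP; rewrite /X inE.
Qed.

Lemma ExpectE n (f : config n -> bool) : Expect f = prob R f.
Proof. by rewrite /prob meanE. Qed.

Lemma powR_exponent_le (alpha : R) n k : alpha < 1 / 22 -> (0 < n)%N ->
  k%:R <= (n%:R : R) `^ alpha -> (k ^ 22 <= n)%N.
Proof.
move=> al n0 kn; rewrite -(ler_nat R) natrX.
have n1 : 1 <= n%:R :> R by rewrite ler1n.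
have h : k%:R <= (n%:R : R) `^ (1 / 22) by apply: le_trans kn _; apply: ler_powR => //; exact: ltW.
apply: le_trans (_ : ((n%:R : R) `^ (1 / 22)) ^+ 22 <= _).
  by apply: lerXn2r => //; rewrite nnegrE ?ler0n ?powR_ge0.
rewrite -powR_mulrn ?powR_ge0 // -powRrM (_ : 1 / 22 * 22%:R = 1) ?powRr1 ?ler0n //.
by field.
Qed.

Variables (a b alpha beta : R) (k : nat -> nat) (q : nat -> R).
Hypotheses (a0 : 0 < a) (ab : a < b) (al : alpha < 1 / 22) (beta01 : 0 < beta < 1).
Hypothesis kP : forall n : nat, (0 < n)%N -> (0 < k n)%N /\ (k n)%:R <= (n%:R : R) `^ alpha.
Hypothesis qP : forall n : nat, (0 < n)%N -> is_quantile beta (tau a b n (k n)) (q n).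

Local Notation ptl n := (prob R (fun w => tau a b n (k n) w < q n)).
Local Notation ptle n := (prob R (fun w => tau a b n (k n) w <= q n)).

Lemma quantileE n : (0 < n)%N -> ptl n <= beta /\ beta <= ptle n.
Proof. by move=> /qP /andP[]; rewrite !ProbE. Qed.

Lemma eventually_scale (M : R) : exists n0 : nat, forall n, (n0 <= n)%N ->
  exists r, [/\ (10 <= r)%N, (k n ^ 2 <= r)%N, (r ^ 8 <= n)%N, (n < r.+1 ^ 8)%N & M <= r%:R] /\
    (0 < n)%N /\ (0 < k n)%N.
Proof.
pose r0 := (10 + Num.bound `|M|)%N; exists (r0 ^ 8)%N => n rn.
have n0 : (0 < n)%N by apply: leq_trans rn; rewrite expn_gt0.
have [k0 kle] := kP n0.
have [r [r0r rn' nr k2]] := scale_exists (powR_exponent_le al n0 kle) n0 k0 rn.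
exists r; split=> //; split=> //; first by apply: leq_trans r0r; rewrite leq_addr.
apply: le_trans (ler_norm _) _; apply: le_trans (ltW (archi_boundP (normr_ge0 M))) _.
by rewrite ler_nat; apply: leq_trans r0r; rewrite leq_addl.
Qed.

(** [c = 1 - beta] bounds from below the probability of [tau >= q]. With [lambda = eta / k] the main
    term of [atom_prob_le] is [eta / c = e / 2]; the other errors are of order 1/r. *)
Lemma atom_eventually_small (e : R) : 0 < e ->
  exists n0 : nat, forall n, (n0 <= n)%N -> (0 < n)%N /\ ptle n - ptl n <= e.
Proof.
move=> e0; have /andP[b0 b1] := beta01.
pose c : R := 1 - beta; have c0 : 0 < c by rewrite subr_gt0.
pose eta : R := e * c / 2; have eta0 : 0 < eta by rewrite divr_gt0 // mulr_gt0.
have [C1 C1E] : exists C, C = 256 * 56 * 1024 ^+ 2 / eta ^+ 3 by eexists.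
have [C2 C2E] : exists C, C = 256 * (72 ^+ 18) :> R by eexists.
have [n0 H] := eventually_scale (2 * (C1 + C2) / e); exists n0 => n /H[r [[r10 k2 rn nr Mr] [n1 k0]]].
split=> //; have kn := scale_kn r10 k0 k2 rn.
have rp : 0 < r%:R :> R by rewrite ltr0n; apply: leq_trans r10.
have kp : 0 < (k n)%:R :> R by rewrite ltr0n.
have cle : c <= prob R (fun w => ~~ (tau a b n (k n) w < q n)).
  by rewrite probC lerB //; case: (quantileE n1).
have l0 : 0 < eta / (k n)%:R by rewrite divr_gt0.
have := atom_prob_le kn a0 ab c0 cle (scale_delta01 R r10 k0 k2 rn nr) l0
  (scale_edges7 R r10 k0 k2 rn nr).
have T := scale_tilt_error r10 k0 k2 rn nr eta0.
have B := scale_bad_error R r10 k0 k2 rn nr.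
rewrite -C1E in T; rewrite -C2E in B.
move=> A; apply: le_trans A _; rewrite mulrDr.
have -> : eta / (k n)%:R * ((k n)%:R * c^-1) = e / 2.
  by rewrite /eta; field; rewrite !gt_eqF.
have CE : C1 / r%:R + C2 / r%:R <= e / 2.
  rewrite -mulrDl ler_pdivrMr //; move: Mr; rewrite ler_pdivrMr //; lra.
move: T B CE; lra.
Qed.

(** [beta] lies between the probabilities of [tau < q] and [tau <= q], whose difference vanishes. *)
Lemma cvg_below_quantile : (fun n => Prob (fun w => tau a b n (k n) w < q n)) @ \oo --> beta.
Proof.
apply/cvgrPdist_le => e e0; have [n0 H] := atom_eventually_small e0.
exists n0 => // n /= /H[n1 A]; rewrite ProbE.
have [? ?] := quantileE n1; rewrite ler_norml; apply/andP; split; lra.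
Qed.

Lemma prob_above n : prob R (fun w => tau a b n (k n) w > q n) = 1 - ptle n.
Proof. by rewrite -probC; apply: eq_prob => w; rewrite ltNge. Qed.

Lemma cvg_above_quantile :
  (fun n => Prob (fun w => tau a b n (k n) w > q n)) @ \oo --> 1 - beta.
Proof.
apply/cvgrPdist_le => e e0; have [n0 H] := atom_eventually_small e0.
exists n0 => // n /= /H[n1 A]; rewrite ProbE prob_above.
have [? ?] := quantileE n1; rewrite ler_norml; apply/andP; split; lra.
Qed.

(** [tau > q] means that no window is crossed in time at most [q]. Once the atom is at most [c],
    this has probability at least [1 - beta - c = c]. The choice of [eta] makes [eta * (2 / c)]
    equal to [e]. *)
Lemma above_noise_sensitive : noise_sensitive (R := R) (fun n w => tau a b n (k n) w > q n).
Proof.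
move=> eps eps0 eps1; have /andP[b0 b1] := beta01.
pose c : R := (1 - beta) / 2; have c0 : 0 < c by rewrite divr_gt0 // subr_gt0.
apply/cvgrPdist_le => e e0.
pose eta : R := e * c / 2; have eta0 : 0 < eta by rewrite divr_gt0 // mulr_gt0.
have eps01 : 0 < eps <= 1 by rewrite eps0.
(* [p0] is fixed before [n], so the crossing probabilities around a block, of order 1/r, fall below
   it. *)
have [p0 p00 sse] := small_set_expansion eps01 eta0.
have [n0 A] := atom_eventually_small c0.
have [n2 S] := eventually_scale (6 / c / p0).
exists (maxn n0 n2) => // n /=; rewrite geq_max => /andP[/A[n1 An] /S[r [[r10 k2 rn nr Mr] [_ k0]]]].
have kn := scale_kn r10 k0 k2 rn.
pose P : pred R := fun t => t <= q n.
pose none (w : config n) := ~~ [exists m : 'I_(n - k n).+1, window_crossed a b (k n) P m w].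
have fE : (fun w : config n => tau a b n (k n) w > q n) = none.
  apply/funext => w; rewrite ltNge; congr (~~ _).
  apply: (tau_crossed w a0 ab (P := P) kn) => s t st; exact: le_trans st.
have cle : c <= prob R none.
  rewrite -fE prob_above; have [? ?] := quantileE n1; rewrite /c; move: An; rewrite /c; lra.
have rp : 0 < r%:R :> R by rewrite ltr0n; apply: leq_trans r10.
have wp := window_prob_le kn c0 cle.
have p0le := scale_window_error r10 k0 k2 rn nr c0 (prob_ge0 _ _) wp.
have p0le' : (3 * k n)%:R * prob R (window_crossed (n := n) a b (k n) P 0) <= p0.
  apply: le_trans p0le _; by rewrite ler_pdivrMr //; move: Mr; rewrite ler_pdivrMr // (mulrC r%:R).
have := window_noise_le kn eps01 eta0 c0 (sse (E n)) cle p0le'.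
move=> H; rewrite sub0r normrN fE ExpectE; apply: le_trans H _.
by rewrite /eta le_eqVlt; apply/orP; left; apply/eqP; field; rewrite gt_eqF.
Qed.

End Theorem1p1.

Theorem theorem1p1 (R : realType) (a b alpha beta : R) (k : nat -> nat) (q : nat -> R) :
  0 < a -> a < b -> alpha < 1 / 22 -> 0 < beta < 1 ->
  (forall n : nat, (0 < n)%N -> (0 < k n)%N /\ (k n)%:R <= (n%:R : R) `^ alpha) ->
  (forall n : nat, (0 < n)%N -> is_quantile beta (tau a b n (k n)) (q n)) ->
  [/\ (fun n => Prob (fun w => tau a b n (k n) w < q n)) @ \oo --> beta,
      (fun n => Prob (fun w => tau a b n (k n) w > q n)) @ \oo --> 1 - beta &
      noise_sensitive (R := R) (fun n w => tau a b n (k n) w > q n)].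
Proof.
move=> a0 ab al beta01 kP qP; split.
- exact: cvg_below_quantile a0 ab al beta01 kP qP.
- exact: cvg_above_quantile a0 ab al beta01 kP qP.
- exact: above_noise_sensitive a0 ab al beta01 kP qP.
Qed.
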